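(* Let $(G,S)$ be a right-angled Artin group. For all $w\in G$, $$\mathrm{Stab}(\bullet_w)=\mathrm{Stab}(\varphi_w)=\mathrm{Stab}(X_w)=Z_G(w)=\bigcap_{p\in\mathrm{Prim}(w)}Z_G(p),$$ and for all $w,a\in G$, $$\mathrm{Stab}(\vee_{w;a})=\mathrm{Stab}(\Psi_{w,\varphi_w(a)})=\mathrm{Stab}(X_{w,\varphi_w(a)})$$ is the free Abelian group generated by $\mathrm{Prim}(w)$.
   Context: $(G,S)$ is a right-angled Artin group: $S\subseteq G$ is a (possibly infinite) generating set of the group $G$ with $S\cap S^{-1}=\emptyset$, and $G$ has the presentation $\langle S\,;\,[s,t]=1$ for those $s\neq t$ in $S$ with $st=ts$ in $G\rangle$. Let $l$ be the word length on $G$ with respect to $S\cup S^{-1}$. Write $x\subset y$ iff $l(x)+l(x^{-1}y)=l(y)$; this is a partial order with least element $1$, in which any two elements have a greatest lower bound $x\cap y$. Elements $x,y$ are orthogonal, $x\perp y$, if $x\cap y=1$ and $x,y$ have a least upper bound for $\subset$ (equivalently, a common upper bound). Put $[x,y]=\{z\in G: x^{-1}z\subset x^{-1}y\}$ and $Y(x,y,z)=x(x^{-1}y\cap x^{-1}z)$, the unique element of $[x,y]\cap[y,z]\cap[z,x]$. A subset $I$ is convex if $[x,y]\subseteq I$ for all $x,y\in I$; the convex closure of a set is the smallest convex set containing it. An element $w$ is cyclically reduced if $w\cap w^{-1}=1$. For $w\in G$ put $\varphi_w(x)=Y(wx,x,w^{-1}x)$ and $X_w=\varphi_w(G)=\{x\in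 G: x^{-1}wx \text{ is cyclically reduced}\}$. For $a\in X_w$ let $X_{w,a}$ be the convex closure of $\{w^na:n\in\mathbb Z\}$, and let $\Psi_{w,a}:G\to G$ be the folding associated to $X_{w,a}$: $\Psi_{w,a}(x)$ is the unique element of $X_{w,a}$ lying in $[x,c]$ for every $c\in X_{w,a}$. $Z_G(w)$ denotes the centralizer. For a cyclically reduced $v$ put $H_v=Z_G(v)\cap X_{v,1}$. An element $w\neq1$ is primitive if for some (equivalently, for all) $a\in X_w$ the group $H_{a^{-1}wa}$ is cyclic, generated by $a^{-1}wa$. Every $w\in G$ can be written, uniquely up to order of the factors, as $w=\prod_{i=1}^n p_i^{m_i}$ with $p_i$ primitive, $m_i\ge1$, and $a^{-1}p_ia\perp a^{-1}p_ja$ for all $i\neq j$ and all $a\in X_w$; $\mathrm{Prim}(w)=\{p_1,\dots,p_n\}$ (so $\mathrm{Prim}(1)=\emptyset$; the empty intersection of subgroups of $G$ is $G$). For $w\in G$ let $\preceq_w$ be the preorder $x\preceq_wy\iff y\in[x,wy]$. For $x,y\in G$ the set $U_{x,y}=\{z\in[x,y]:x\preceq_wz,\ y\preceq_wz\}$ is nonempty and convex, and $x\bullet_wy$ denotes its element nearest to $x$, i.e. the unique $c\in U_{x,y}$ with $c\in[x,z]$ for all $z\in U_{x,y}$. For $a\in G$ put $x\vee_{w;a}y=Y(x\bullet_wy,\,a,\,y\bullet_wx)$. $\mathrm{Stab}$ denotes the stabilizer in $G$ for the actions of $G$ induced by left multiplication: on subsets, $g\cdot X=gX$; on maps $\varphi:G\to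 G$, $(g\cdot\varphi)(x)=g\varphi(g^{-1}x)$; on binary operations $*$ on $G$, $x\,(g\cdot * )\,y=g\big((g^{-1}x)*(g^{-1}y)\big)$. *)

(* Defs.v *)
From mathcomp Require Import all_boot all_order all_algebra.
From mathcomp Require Import boolp classical_sets.

Set Implicit Arguments.
Unset Strict Implicit.
Unset Printing Implicit Defensive.

Local Open Scope classical_set_scope.
Local Open Scope group_scope.

(* Points that the mathematics describes as "the unique element such that"
   are chosen with [xget]; the default value given to [xget] is irrelevant
   whenever the element exists. *)

(* A word is a sequence of pairs (s, e), where (s, true) stands for s and
   (s, false) for s^-1. *)
Definition letter {G : groupType} (c : G * bool) : G :=
  if c.2 then c.1 else c.1^-1.

Definition weval {G : groupType} (u : seq (G * bool)) : G :=
  \prod_(c <- u) letter c.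

Definition is_word {G : groupType} (S : set G) (u : seq (G * bool)) : Prop :=
  forall c, c \in u -> S c.1.

(* The congruence on words over S and its formal inverses whose quotient is
   the group <S ; [s, t] = 1 for s != t in S with st = ts in G>. *)
Inductive word_equiv {G : groupType} (S : set G) :
    seq (G * bool) -> seq (G * bool) -> Prop :=
| we_refl u : word_equiv S u u
| we_sym u v : word_equiv S u v -> word_equiv S v u
| we_trans u v w : word_equiv S u v -> word_equiv S v w -> word_equiv S u w
| we_ctx a b u v : word_equiv S u v -> word_equiv S (a ++ u ++ b) (a ++ v ++ b)
| we_cancel s e : S s -> word_equiv S [:: (s, e); (s, ~~ e)] [::]
| we_comm s t : S s -> S t -> s <> t -> commute s t ->
    word_equiv S [:: (s, true); (t, true)] [:: (t, true); (s, true)].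

Record is_raag {G : groupType} (S : set G) : Prop := IsRaag {
  raag_disjoint : forall s, S s -> ~ S s^-1;
  raag_generated : forall x : G, exists2 u, is_word S u & weval u = x;
  raag_presented : forall u v, is_word S u -> is_word S v ->
    weval u = weval v -> word_equiv S u v
}.

Definition wlength {G : groupType} (S : set G) (x : G) : nat :=
  xget 0%N [set n | (exists u, [/\ is_word S u, weval u = x & size u = n]) /\
                    (forall u, is_word S u -> weval u = x -> (n <= size u)%N)].

Definition wle {G : groupType} (S : set G) (x y : G) : Prop :=
  (wlength S x + wlength S (x^-1 * y))%N = wlength S y.

Definition is_glb {G : groupType} (S : set G) (x y z : G) : Prop :=
  [/\ wle S z x, wle S z y &
      forall t, wle S t x -> wle S t y -> wle S t z].

Definition is_lub {G : groupType} (S : set G) (x y z : G) : Prop :=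
  [/\ wle S x z, wle S y z &
      forall t, wle S x t -> wle S y t -> wle S z t].

Definition wmeet {G : groupType} (S : set G) (x y : G) : G :=
  xget 1 [set z | is_glb S x y z].

Definition perp {G : groupType} (S : set G) (x y : G) : Prop :=
  wmeet S x y = 1 /\ exists z, is_lub S x y z.

Definition segment {G : groupType} (S : set G) (x y : G) : set G :=
  [set z | wle S (x^-1 * z) (x^-1 * y)].

Definition median {G : groupType} (S : set G) (x y z : G) : G :=
  x * wmeet S (x^-1 * y) (x^-1 * z).

Definition is_convex {G : groupType} (S : set G) (I : set G) : Prop :=
  forall x y, I x -> I y -> segment S x y `<=` I.

Definition convex_closure {G : groupType} (S : set G) (A : set G) : set G :=
  smallest (is_convex S) A.

Definition expgz {G : groupType} (x : G) (n : int) : G :=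
  match n with Posz m => x ^+ m | Negz m => x ^- m.+1 end.

Definition cyclically_reduced {G : groupType} (S : set G) (w : G) : Prop :=
  wmeet S w w^-1 = 1.

Definition phi {G : groupType} (S : set G) (w : G) : G -> G :=
  fun x => median S (w * x) x (w^-1 * x).

Definition Xset {G : groupType} (S : set G) (w : G) : set G := range (phi S w).

Definition Xaxis {G : groupType} (S : set G) (w a : G) : set G :=
  convex_closure S (range (fun n : int => expgz w n * a)).

Definition Psi {G : groupType} (S : set G) (w a : G) : G -> G :=
  fun x => xget 1 [set d | Xaxis S w a d /\
                           forall c, Xaxis S w a c -> segment S x c d].

Definition centralizer {G : groupType} (w : G) : set G :=
  [set g | commute g w].

Definition Hgroup {G : groupType} (S : set G) (v : G) : set G :=
  centralizer v `&` Xaxis S v 1.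

(* [w ^ a] is the conjugate a^-1 w a. *)
Definition primitive {G : groupType} (S : set G) (w : G) : Prop :=
  w <> 1 /\ exists2 a, Xset S w a & Hgroup S (w ^ a) = range (expgz (w ^ a)).

Definition is_prim_decomposition {G : groupType} (S : set G) (w : G)
    (n : nat) (p : 'I_n -> G) (m : 'I_n -> nat) : Prop :=
  [/\ w = \prod_(i < n) p i ^+ m i,
      forall i, primitive S (p i),
      forall i, (1 <= m i)%N &
      forall i j, i != j -> forall a, Xset S w a -> perp S (p i ^ a) (p j ^ a)].

Definition Prim {G : groupType} (S : set G) (w : G) : set G :=
  [set x | exists (n : nat) (p : 'I_n -> G) (m : 'I_n -> nat),
             is_prim_decomposition S w p m /\ range p x].

Definition preceq {G : groupType} (S : set G) (w x y : G) : Prop :=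
  segment S x (w * y) y.

Definition Uset {G : groupType} (S : set G) (w x y : G) : set G :=
  [set z | [/\ segment S x y z, preceq S w x z & preceq S w y z]].

Definition bullet {G : groupType} (S : set G) (w : G) : G -> G -> G :=
  fun x y => xget 1 [set c | Uset S w x y c /\
                             forall z, Uset S w x y z -> segment S x z c].

Definition vee {G : groupType} (S : set G) (w a : G) : G -> G -> G :=
  fun x y => median S (bullet S w x y) a (bullet S w y x).

Definition act_set {G : groupType} (g : G) (X : set G) : set G :=
  [set g * x | x in X].

Definition act_map {G : groupType} (g : G) (f : G -> G) : G -> G :=
  fun x => g * f (g^-1 * x).

Definition act_op {G : groupType} (g : G) (op : G -> G -> G) : G -> G -> G :=
  fun x y => g * op (g^-1 * x) (g^-1 * y).

Definition Stab {G : groupType} {T : Type} (act : G -> T -> T) (t : T) : set G :=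
  [set g | act g t = t].

Definition is_subgroup {G : groupType} (H : set G) : Prop :=
  H 1 /\ forall x y, H x -> H y -> H (x * y^-1).

(* H is the subgroup generated by P, it is abelian, and P is a Z-basis of it. *)
Definition free_abelian_on {G : groupType} (H P : set G) : Prop :=
  [/\ H = smallest is_subgroup P,
      forall p q, P p -> P q -> commute p q &
      forall (s : seq G) (n : G -> int),
        uniq s -> (forall p, p \in s -> P p) ->
        \prod_(p <- s) expgz p (n p) = 1 ->
        forall p, p \in s -> n p = 0%R].

(* Main.v *)
(* Walls of the Cayley graph of (G,S) are classes of edges, indexed by cosets
   of the subgroups generated by the letters commuting with a given letter.  An
   element of G is determined by the sides of the walls on which it lies, the
   length counts separating walls, and medians are majority votes.  Walls with
   non-commuting or equal labels cannot cross.

   For a fixed w, a wall is either fixed by w, or crossed by the axes of w (its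
   translates are nested), or has a side disjoint from all its translates.  This
   gives coordinates to phi_w, X_w, X_(w,a), Psi_(w,a) and, through the limits
   of w^n x, to the operations bullet_w and vee_(w;a).  An element g stabilizing
   one of them permutes the walls crossed by the axes of w and preserves their
   orientation: reversing a chain of walls, g^2 would fix a wall, and g too
   because roots of elements of a parabolic subgroup stay in it.  Comparing the
   signed numbers of walls between g w x and w g x yields g w = w g.

   These signed numbers, one for each label, embed the stabilizer of X_(w,a)
   into a free Abelian group.  Labels at which an element has different signs
   commute, so that the positive cone is closed under minima; hence its atoms
   have disjoint supports and form a basis, and they are the elements of
   Prim(w). *)

Require Import Defs.
From mathcomp Require Import all_boot all_order all_algebra.
From mathcomp Require Import boolp classical_sets.
From mathcomp Require Import zify.

Set Implicit Arguments.
Unset Strict Implicit.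
Unset Printing Implicit Defensive.

Local Open Scope classical_set_scope.
Local Open Scope group_scope.

Import Order.TTheory GRing.Theory Num.Theory.

(** * Words *)

(** Each operation of the statement is shown to act coordinatewise, through [maj] and [lim], so that
    identities become Boolean checks on a single wall, split according to its type. [S] may be
    infinite; what replaces compactness is that only finitely many walls separate two given points,
    so that for the walls at issue a limit can be replaced by one honest point [w ^+ n * x]. The
    stabilizers differ in what they remember of these limits, but each remembers enough for the
    common criterion [commute_criterion]. In the positive cone, minima come from a positive part,
    cut out by a retraction onto the labels where an element is positive; factorizations terminate
    because word length, measured from the base point, is additive on the cone. *)

Lemma not_sorted_split (T : Type) (e : rel T) (r : seq T) : ~~ sorted e r ->
  exists r1 x y r2, r = r1 ++ x :: y :: r2 /\ ~~ e x y.
Proof.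
elim: r => [//|x [//|y r] IH] /=; rewrite negb_and => /orP[xy|/IH].
  by exists [::], x, y, r.
by move=> [r1 [x' [y' [r2 [-> H]]]]]; exists (x :: r1), x', y', r2.
Qed.

Lemma filter_cons_split (T : Type) (p : pred T) (u r : seq T) x : filter p u = x :: r ->
  exists u1 u2, [/\ u = u1 ++ x :: u2, filter p u1 = [::], p x & filter p u2 = r].
Proof.
elim: u => [//|y u IH] /=; case py: (p y).
  by case=> <- <-; exists [::], u.
move=> /IH.
move=> [u1 [u2 [-> H px E]]]; exists (y :: u1), u2; by rewrite /= py.
Qed.

Lemma filter_cat_split (T : Type) (p : pred T) (u r1 r2 : seq T) : filter p u = r1 ++ r2 ->
  exists u1 u2, [/\ u = u1 ++ u2, filter p u1 = r1 & filter p u2 = r2].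
Proof.
elim: r1 u => [|x r1 IH] u /=; first by exists [::], u.
move=> H; have [u1 [u2 [-> E1 px E]]] := filter_cons_split H.
have [v1 [v2 [-> E2 E3]]] := IH _ E; exists (u1 ++ x :: v1), v2; split=> //; first by rewrite -catA.
by rewrite filter_cat E1 /= px E2.
Qed.

Lemma sorted_glue (T : Type) (e : rel T) (x : T) (r1 r2 r3 : seq T) :
  sorted e (r1 ++ x :: r2) -> sorted e (x :: r2 ++ r3) -> sorted e (r1 ++ (x :: r2) ++ r3).
Proof.
case: r1 => [//|y r1] /=; rewrite !cat_path /= => /and3P[-> -> _].
by rewrite cat_path => /andP[-> ->].
Qed.

Lemma flatten_nseq_filter (T : Type) (p : pred T) (r : seq T) m :
  filter p (flatten (nseq m r)) = flatten (nseq m (filter p r)).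
Proof. by rewrite filter_flatten map_nseq. Qed.

(** Sortedness only constrains neighbours, and repeating a nonempty [r2] creates no seam besides
    those of the two hypotheses. This is how powers of a cyclically reduced word are seen to be
    reduced. *)
Lemma sorted_pump (T : Type) (e : rel T) (r1 r2 r3 : seq T) m :
  sorted e (r1 ++ r2 ++ r3) -> sorted e (r2 ++ r2) ->
  sorted e (r1 ++ flatten (nseq m.+1 r2) ++ r3).
Proof.
case: r2 => [|x r2]; first by elim: m.
rewrite catA => H1 H2; have /cat_sorted2[H3 _] := H1.
elim: m => [|m IH].
  have -> : flatten (nseq 1 (x :: r2)) = x :: r2 by rewrite /= cats0.
  by rewrite catA.
have -> : flatten (nseq m.+2 (x :: r2)) = (x :: r2) ++ flatten (nseq m.+1 (x :: r2)) by [].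
rewrite -catA; apply: sorted_glue => //.
have /cat_sorted2[_] := IH.
have -> : flatten (nseq m.+1 (x :: r2)) = (x :: r2) ++ flatten (nseq m (x :: r2)) by [].
rewrite -[(_ ++ _) ++ r3]catA => H4.
exact: (@sorted_glue _ e x (x :: r2) r2).
Qed.

Section Words.
Context {G : groupType}.
Implicit Types (x y : G) (S T : set G) (u v : seq (G * bool)) (c : G * bool).

Lemma weval_nil : weval [::] = 1 :> G.
Proof. by rewrite /weval big_nil. Qed.

Lemma weval_cons c u : weval (c :: u) = letter c * weval u.
Proof. by rewrite /weval big_cons. Qed.

Lemma weval_cat u v : weval (u ++ v) = weval u * weval v.
Proof. by rewrite /weval big_cat. Qed.

Lemma weval1 c : weval [:: c] = letter c.
Proof. by rewrite weval_cons weval_nil mulg1. Qed.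

Definition cinv c : G * bool := (c.1, ~~ c.2).

Definition winv u := rev [seq cinv c | c <- u].

Lemma letter_cinv c : letter (cinv c) = (letter c)^-1.
Proof. by case: c => s []; rewrite /letter //= invgK. Qed.

Lemma cinvK : involutive cinv.
Proof. by case=> s []. Qed.

Lemma weval_winv u : weval (winv u) = (weval u)^-1.
Proof.
elim: u => [|c u IH]; first by rewrite /winv weval_nil invg1.
rewrite /winv map_cons rev_cons -cats1 weval_cat weval1 letter_cinv.
by rewrite weval_cons invgM -IH.
Qed.

Lemma is_word_cat S u v : is_word S (u ++ v) <-> is_word S u /\ is_word S v.
Proof.
split=> [H|[Hu Hv] c].
  by split=> c Hc; apply: H; rewrite mem_cat Hc ?orbT.
by rewrite mem_cat => /orP[/Hu|/Hv].
Qed.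

Lemma is_word_cons S c u : is_word S (c :: u) <-> S c.1 /\ is_word S u.
Proof.
split=> [H|[Hc Hu] d].
  by split=> [|d Hd]; apply: H; rewrite inE ?eqxx ?Hd ?orbT.
by rewrite inE => /orP[/eqP->|/Hu].
Qed.

Lemma mem_winv c u : (c \in winv u) = (cinv c \in u).
Proof.
by rewrite mem_rev -{1}[c]cinvK mem_map //; apply: can_inj cinvK.
Qed.

Lemma is_word_winv S u : is_word S u -> is_word S (winv u).
Proof. by move=> H c; rewrite mem_winv => /H. Qed.

Lemma is_word_filter S (P : pred (G * bool)) u :
  is_word S u -> is_word S (filter P u).
Proof. by move=> H c; rewrite mem_filter => /andP[_ /H]. Qed.

Lemma word_equiv_weval S u v : word_equiv S u v -> weval u = weval v.
Proof.
elim=> {u v} [//|u v _ -> //|u v w _ -> _ -> //|a b u v _ E|s e _|s t _ _ _ st].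
- by rewrite !weval_cat E.
- by case: e; rewrite weval_cons weval1 weval_nil /letter /= (mulgV, mulVg).
- by rewrite !weval_cons !weval_nil !mulg1 /letter /=.
Qed.

(** The standard parabolic subgroup generated by the elements of [S] lying in [T]. *)
Definition gen S T : set G :=
  [set x | exists u, [/\ is_word S u, forall c, c \in u -> T c.1 & weval u = x]].

Lemma gen1 S T : gen S T 1.
Proof. by exists [::]; split=> //; exact: weval_nil. Qed.

Lemma genM S T x y : gen S T x -> gen S T y -> gen S T (x * y).
Proof.
move=> [u [Su Tu <-]] [v [Sv Tv <-]]; exists (u ++ v); split.
- exact/is_word_cat.
- by move=> c; rewrite mem_cat => /orP[/Tu|/Tv].
- exact: weval_cat.
Qed.

Lemma genV S T x : gen S T x -> gen S T x^-1.
Proof.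
move=> [u [Su Tu <-]]; exists (winv u); split.
- exact: is_word_winv.
- by move=> c; rewrite mem_winv => /Tu.
- exact: weval_winv.
Qed.

Lemma genX S T x n : gen S T x -> gen S T (x ^+ n).
Proof. by move=> Tx; elim: n => [|n IH]; [exact: gen1|rewrite expgS; exact: genM]. Qed.

Lemma gen_sub S T T' : T `<=` T' -> gen S T `<=` gen S T'.
Proof. by move=> TT' _ [u [Su Tu <-]]; exists u; split=> // c /Tu /TT'. Qed.

Lemma commuteVl x y : commute x y -> commute x^-1 y.
Proof. by move=> xy; apply: commute_sym; apply: commuteV; apply: commute_sym. Qed.

Lemma commute_letter c d : commute c.1 d.1 -> commute (letter c) (letter d) :> Prop.
Proof.
case: c d => [s e] [t f] /= st; rewrite /letter /=.
have st' : commute t s by apply: commute_sym.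
case: e f => [] [] //.
- exact: commuteV.
- by apply: commute_sym; exact: commuteV.
- by apply: commuteV; apply: commute_sym; exact: commuteV.
Qed.

Lemma commute_weval u x :
  (forall c, c \in u -> commute x (letter c)) -> commute x (weval u).
Proof.
move=> H; rewrite /weval.
elim: u H => [|c u IH] H; first by rewrite big_nil; exact: commute1.
rewrite big_cons; apply: commuteM; first by apply: H; rewrite mem_head.
by apply: IH => d Hd; apply: H; rewrite inE Hd orbT.
Qed.

Lemma commute_gen S T T' x y : (forall s t, S s -> S t -> T s -> T' t -> commute s t) ->
  gen S T x -> gen S T' y -> commute x y.
Proof.
move=> H [u [Su Tu <-]] [v [Sv Tv <-]].
apply: commute_weval => d dv; apply: commute_sym; apply: commute_weval => c cu.
apply: commute_letter; apply: commute_sym; apply: H; by [exact: Su|exact: Sv|exact: Tu|exact: Tv].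
Qed.

(** The link of [s] in the commutation graph. Excluding [s] itself matters: [lk S s s] is the
    contradiction reached in arguments about walls with one label. *)
Definition lk S (s : G) : set G := [set t | [/\ S t, t <> s & commute s t]].

Lemma commute_lk S s x : gen S (lk S s) x -> commute s x.
Proof.
move=> [u [Su Lu <-]]; apply: commute_weval => c /Lu [_ _ sc].
by have := @commute_letter (s, true) c sc.
Qed.

(* The edge leaving [x] along the letter [c] runs between [base x c] and
   [base x c * c.1]. *)
Definition base (x : G) c : G := if c.2 then x else x * c.1^-1.

(** Opposite edges of a commuting square have the same label, and their bases differ by a letter of
    the link; so parallel edges are those with bases in one left coset of [gen S (lk S s)]. *)
Definition edge S (s g x : G) c : bool :=
  `[< c.1 = s /\ gen S (lk S s) (g^-1 * base x c) >].

Fixpoint cross S (s g x : G) u : bool :=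
  if u is c :: u' then edge S s g x c (+) cross S s g (x * letter c) u'
  else false.

Lemma baseM k x c : base (k * x) c = k * base x c.
Proof. by rewrite /base; case: c.2; rewrite ?mulgA. Qed.

Lemma cross_cat S s g x u v :
  cross S s g x (u ++ v) = cross S s g x u (+) cross S s g (x * weval u) v.
Proof.
elim: u x => [|c u IH] x; first by rewrite weval_nil mulg1.
by rewrite /= IH weval_cons mulgA addbA.
Qed.

Lemma crossM S k s g x u : cross S s (k * g) (k * x) u = cross S s g x u.
Proof.
elim: u x => [//|c u IH] x /=; rewrite -[k * x * _]mulgA IH; congr (_ (+) _).
by rewrite /edge baseM invgM -mulgA mulKg.
Qed.

Lemma edge_cinv S s g x c : edge S s g (x * letter c) (cinv c) = edge S s g x c.
Proof.
by case: c => t []; rewrite /edge /base /letter /= ?mulgK.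
Qed.

Lemma edge_lk S s g x c t : lk S t c.1 -> S t ->
  edge S s g (x * letter c) (t, true) = edge S s g x (t, true).
Proof.
move=> Hc St; rewrite /edge /base /=; apply: asbool_equiv_eq; split=> -[ts].
  subst s; move=> /genM H; split=> //.
  have /H : gen S (lk S t) (letter (cinv c)).
    by exists [:: cinv c]; split; [move=> d; rewrite inE => /eqP->; case: Hc|
       move=> d; rewrite inE => /eqP->|exact: weval1].
  by rewrite letter_cinv mulgA mulgK.
subst s; move=> /genM H; split=> //; rewrite mulgA; apply: H.
by exists [:: c]; split; [move=> d; rewrite inE => /eqP->; case: Hc|
       move=> d; rewrite inE => /eqP->|exact: weval1].
Qed.

(** The relations preserve parity: a cancelling pair traverses one edge twice, and opposite edges of
    a commuting square belong to the same wall. *)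
Lemma cross_equiv S s g x u v : word_equiv S u v -> cross S s g x u = cross S s g x v.
Proof.
move=> E; elim: E x => {u v}
  [//|u v _ E x|u v w _ E1 _ E2 x|a b u v E IH x|t e St x|t t' St St' tt' ct x].
- by rewrite E.
- by rewrite E1 E2.
- by rewrite !cross_cat IH (word_equiv_weval E).
- by rewrite /= (edge_cinv S s g x (t, e)) addbF addbb.
- rewrite /= !addbF.
  have L1 : lk S t (t', true).1 by split=> //; exact: nesym.
  have L2 : lk S t' (t, true).1 by split=> //; exact: commute_sym.
  by rewrite (edge_lk s g x L1 St) (edge_lk s g x L2 St') addbC.
Qed.

End Words.

Definition word {G : groupType} (S : set G) (x : G) : seq (G * bool) :=
  xget [::] [set u | is_word S u /\ weval u = x].

(* A wall is given by a pair [(s, g)], standing for the class of the edge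
   between [g] and [g * s]; [side] tells on which side of the wall a point
   lies, with [g] itself on the side [false]. *)
Definition side {G : groupType} (S : set G) (h : G * G) (x : G) : bool :=
  cross S h.1 h.2 h.2 (word S (h.2^-1 * x)).

Definition mv {G : groupType} (k : G) (h : G * G) : G * G := (h.1, k * h.2).

(** The side function does not depend on the representative [g] in its coset, so a wall given by
    different edges is one object, which can be listed and counted. *)
Definition wall {G : groupType} (S : set G) (h : G * G) : G * (G -> bool) :=
  (h.1, side S h).

Fixpoint walls {G : groupType} (S : set G) (x : G) (u : seq (G * bool)) :=
  if u is c :: u' then wall S (c.1, base x c) :: walls S (x * letter c) u'
  else [::].

Definition geodesic {G : groupType} (S : set G) (u : seq (G * bool)) : Prop :=
  is_word S u /\ forall v, is_word S v -> weval v = weval u -> (size u <= size v)%N.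

Definition maj (a b c : bool) : bool := if a == b then a else c.

Section RightAngledArtin.
Context (G : groupType) (S : set G) (GS : is_raag S).

(** * Sides of walls and geodesic words *)

Section Sides.
Implicit Types (s t g k x y z : G) (h : G * G) (u v : seq (G * bool)) (c : G * bool).

Lemma wordP x : is_word S (word S x) /\ weval (word S x) = x.
Proof.
have [u Su ux] := raag_generated GS x.
by apply: (@xgetPex _ [::] [set u | is_word S u /\ weval u = x]); exists u.
Qed.

Lemma mv1 h : mv 1 h = h.
Proof. by case: h => s g; rewrite /mv mul1g. Qed.

Lemma mvM k k' h : mv (k * k') h = mv k (mv k' h).
Proof. by rewrite /mv /= mulgA. Qed.

Lemma mvK k : cancel (mv k) (@mv G k^-1).
Proof. by move=> h; rewrite -mvM mulVg mv1. Qed.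

Lemma mvVK k : cancel (@mv G k^-1) (mv k).
Proof. by move=> h; rewrite -mvM mulgV mv1. Qed.

(** The presentation makes the word chosen in [side] irrelevant: appending [u] to it gives a word
    equivalent to the one chosen for the new endpoint. *)
Lemma side_path h x u : is_word S u ->
  side S h (x * weval u) = side S h x (+) cross S h.1 h.2 x u.
Proof.
move=> Su; rewrite /side.
have [Sw Ew] := wordP (h.2^-1 * (x * weval u)).
have [Sw' Ew'] := wordP (h.2^-1 * x).
rewrite (@cross_equiv _ S _ _ _ _ (word S (h.2^-1 * x) ++ u)); last first.
  apply: (raag_presented GS) => //; first by apply/is_word_cat.
  by rewrite Ew weval_cat Ew' mulgA.
by rewrite cross_cat Ew' mulVKg.
Qed.

Lemma side_mv k h x : side S (mv k h) (k * x) = side S h x.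
Proof. by rewrite /side /= crossM invgM -mulgA mulKg. Qed.

Lemma side_mvE k h x : side S (mv k h) x = side S h (k^-1 * x).
Proof. by rewrite -{1}(mulVKg k x) side_mv. Qed.

Lemma side_base s g : side S (s, g) g = false.
Proof.
rewrite /side /= mulVg (@cross_equiv _ S _ _ _ _ [::]) //.
have [Sw Ew] := wordP 1.
by apply: (raag_presented GS) => //; rewrite Ew weval_nil.
Qed.

Lemma side_edge h x c : S c.1 ->
  side S h (x * letter c) = side S h x (+) edge S h.1 h.2 x c.
Proof.
move=> Sc; rewrite -(weval1 c) side_path /= ?addbF //.
by apply/is_word_cons.
Qed.

Lemma cross_notin s g x u : (forall c, c \in u -> c.1 <> s) -> cross S s g x u = false.
Proof.
elim: u x => [//|c u IH] x H /=; rewrite IH => [|d du]; last first.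
  by apply: H; rewrite inE du orbT.
by rewrite addbF; apply/negP => /asboolP[/(H _ (mem_head _ _))].
Qed.

Lemma side_eq s g g' : gen S (lk S s) (g^-1 * g') -> side S (s, g') = side S (s, g).
Proof.
move=> L.
have edgeE x c : edge S s g' x c = edge S s g x c.
  rewrite /edge; apply: asbool_equiv_eq; split=> -[-> H]; split=> //.
    by have := genM L H; rewrite -mulgA mulVKg.
  have := genM (genV L) H.
  by rewrite invgM invgK -mulgA mulVKg.
have crossE x u : cross S s g' x u = cross S s g x u.
  by elim: u x => [//|c u IH] x /=; rewrite edgeE IH.
have E : side S (s, g') g = false.
  have [v [Sv Lv Ev]] := L.
  have := side_path (s, g') g Sv; rewrite Ev mulVKg side_base.
  by rewrite cross_notin ?addbF // => c /Lv [].
apply/funext => x; have [Sw Ew] := wordP (g^-1 * x).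
have := side_path (s, g') g Sw; rewrite Ew mulVKg => ->.
have := side_path (s, g) g Sw; rewrite Ew mulVKg => ->.
by rewrite E side_base crossE.
Qed.

Lemma side_base_letter x c : S c.1 ->
  side S (c.1, base x c) x = ~~ c.2 /\ side S (c.1, base x c) (x * letter c) = c.2.
Proof.
case: c => s e /= Ss.
have H y : side S (s, y) (y * s) = true.
  have := @side_edge (s, y) y (s, true) Ss; rewrite /letter /= => ->.
  rewrite side_base /=; apply/asboolP; split=> //; rewrite /base /= mulVg.
  exact: gen1.
case: e; rewrite /base /letter /=; first by rewrite side_base H.
by rewrite side_base -{2}(mulgVK s x) H.
Qed.

(** For the converse, the wall of an edge takes different values at the two ends of that edge; if it
    equals [wall S (s, g)], then [side_edge] forces the edge to be counted for [(s, g)]. *)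
Lemma edgeP s g x c : S c.1 ->
  edge S s g x c = (wall S (c.1, base x c) == wall S (s, g)).
Proof.
move=> Sc; apply/asboolP/eqP.
  by move=> [cs L]; rewrite /wall /= cs (side_eq L).
move=> [cs E]; have [E1 E2] := side_base_letter x Sc.
have := side_edge (s, g) x Sc; rewrite -!E E1 E2 /=.
case Ee: (edge S s g x c); first by move/asboolP: Ee.
by case: c.2.
Qed.

Lemma cross_walls s g x u : is_word S u ->
  cross S s g x u = odd (count_mem (wall S (s, g)) (walls S x u)).
Proof.
elim: u x => [//|c u IH] x /is_word_cons[Sc Su] /=.
by rewrite IH // edgeP // oddD; case: eqP.
Qed.

Lemma side_walls h x u : is_word S u ->
  side S h (x * weval u) = side S h x (+) odd (count_mem (wall S h) (walls S x u)).
Proof. by move=> Su; rewrite side_path // cross_walls //; case: h. Qed.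

Lemma walls_cat x u v : walls S x (u ++ v) = walls S x u ++ walls S (x * weval u) v.
Proof.
elim: u x => [|c u IH] x; first by rewrite weval_nil mulg1.
by rewrite /= IH weval_cons mulgA.
Qed.

Lemma size_walls x u : size (walls S x u) = size u.
Proof. by elim: u x => [//|c u IH] x /=; rewrite IH. Qed.

Lemma mem_walls x u W : W \in walls S x u ->
  exists u1 c u2, u = u1 ++ c :: u2 /\ W = wall S (c.1, base (x * weval u1) c).
Proof.
elim: u x => [//|c u IH] x /=; rewrite inE => /orP[/eqP->|/IH].
  by exists [::], c, u; rewrite weval_nil mulg1.
move=> [u1 [d [u2 [-> ->]]]]; exists (c :: u1), d, u2.
by rewrite weval_cons mulgA.
Qed.

(** A wall met exactly once separates the endpoints, hence is met by every path between them. *)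
Lemma uniq_walls_sub x u v : is_word S u -> is_word S v -> weval u = weval v ->
  uniq (walls S x u) -> {subset walls S x u <= walls S x v}.
Proof.
move=> Su Sv E U W Wu; have [u1 [c [u2 [_ EW]]]] := mem_walls Wu.
have := side_walls (c.1, base (x * weval u1) c) x Su; rewrite E side_walls // -EW.
rewrite (count_uniq_mem _ U) Wu => /addbI /= H.
by rewrite -has_pred1 has_count; case: count H.
Qed.

Lemma uniq_walls_geodesic x u : is_word S u -> uniq (walls S x u) -> geodesic S u.
Proof.
move=> Su U; split=> // v Sv E.
rewrite -(size_walls x u) -(size_walls x v); apply: uniq_leq_size => //.
exact: uniq_walls_sub.
Qed.

(** Labels of walls separating the endpoints occur in every word for the same element; so membership
    in a parabolic subgroup can be read off the letters of a reduced word. *)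
Lemma uniq_walls_gen x u (T : set G) : is_word S u -> uniq (walls S x u) ->
  gen S T (weval u) -> forall c, c \in u -> T c.1.
Proof.
move=> Su U [v [Sv Tv Ev]] c cu.
suff [d dv <-] : exists2 d, d \in v & d.1 = c.1 by exact: Tv.
have H : (c.1 \in [seq W.1 | W <- walls S x u]).
  elim: u x cu {Su U Ev} => [//|d u IH] x; rewrite inE => /orP[/eqP->|/IH H] /=.
    by rewrite inE eqxx.
  by rewrite inE H orbT.
have /mapP[W /(uniq_walls_sub Su Sv (esym Ev) U) /mem_walls] := H.
move=> [v1 [d [v2 [-> ->]]]] ->; exists d => //.
by rewrite mem_cat mem_head orbT.
Qed.

Definition cancels u := exists u1 c u2 u3,
  u = u1 ++ c :: u2 ++ cinv c :: u3 /\ (forall d, d \in u2 -> lk S c.1 d.1).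

(** Choose [c] with its wall met again, while the word after [c] meets no wall twice. The second
    crossing goes the opposite way, and the coset condition puts the word in between in the subgroup
    of the link; being free of repetitions, it has all its letters there. *)
Lemma not_uniq_cancels x u : is_word S u -> ~~ uniq (walls S x u) -> cancels u.
Proof.
elim: u x => [//|c u IH] x /is_word_cons[Sc Su] /=.
case U: (uniq (walls S (x * letter c) u)); last first.
  move=> _; have [|u1 [d [u2 [u3 [-> H]]]]] := IH (x * letter c) Su.
    by rewrite U.
  by exists (c :: u1), d, u2, u3.
rewrite andbT negbK => /mem_walls[u2 [d [u3 [Eu EW]]]].
exists [::], c, u2, u3; have [cd Es] := EW.
move: (U); rewrite Eu walls_cat cat_uniq /= => /and3P[U2 /norP[N2 _] _].
move: Su; rewrite Eu => /is_word_cat[Su2 /is_word_cons[Sd _]].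
have [E1 E2] := side_base_letter x Sc.
have [E3 E4] := side_base_letter (x * letter c * weval u2) Sd.
have : side S (c.1, base x c) (x * letter c * weval u2) = c.2.
  rewrite side_walls // E2 (count_uniq_mem _ U2) EW (negbTE N2).
  by rewrite addbF.
rewrite Es E3 => d2.
have Ed : d = cinv c.
  by case: (c) (d) cd d2 => ? ? [? ?] /= -> <-; rewrite /cinv /= negbK.
rewrite Ed; split=> //; apply: (uniq_walls_gen Su2 U2).
have : edge S c.1 (base x c) (x * letter c * weval u2) d by rewrite edgeP // EW.
move=> /asboolP[_]; rewrite Ed /base /letter /=; case: (c.2) => /=; last first.
  by rewrite mulKg.
(* For positive [c] the coset condition concerns the conjugate of [weval u2] by the letter; that
   conjugate commutes with the letter, hence equals [weval u2]. *)
rewrite -!mulgA mulKg => L; have := commute_lk L.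
rewrite /commute -!mulgA mulVg mulg1 => /mulgI E; move: L.
by rewrite E.
Qed.

Lemma cancels_shorten u : is_word S u -> cancels u -> exists2 v, is_word S v &
  weval v = weval u /\ (size v).+2 = size u.
Proof.
move=> Su [u1 [c [u2 [u3 [E L]]]]]; move: Su; rewrite E.
move=> /is_word_cat[S1] /is_word_cons[Sc] /is_word_cat[S2] /is_word_cons[_ S3].
exists (u1 ++ u2 ++ u3); first by rewrite !is_word_cat.
split; last by rewrite !size_cat /= size_cat /= !addnS.
rewrite !(weval_cat, weval_cons) letter_cinv; congr (_ * _).
have : commute (weval u2) (letter c).
  apply: commute_sym; apply: commute_weval => d /L [_ _ H].
  exact: commute_letter.
by move=> H; rewrite [letter c * _]mulgA -H -mulgA mulVKg.
Qed.

Lemma geodesic_uniq x u : geodesic S u -> uniq (walls S x u).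
Proof.
move=> [Su M]; apply/negPn/negP => /(not_uniq_cancels Su) /(cancels_shorten Su).
move=> [v Sv [Ev Es]]; have := M v Sv Ev.
by rewrite -Es ltnNge leqnSn.
Qed.

Lemma geodesicP u : is_word S u -> geodesic S u \/ cancels u.
Proof.
move=> Su; case U: (uniq (walls S 1 u)).
  by left; apply: uniq_walls_geodesic U.
by right; apply: (@not_uniq_cancels 1); rewrite ?U.
Qed.

Lemma geodesic_not_cancels u : geodesic S u -> ~ cancels u.
Proof.
move=> [Su M] /(cancels_shorten Su) [v Sv [Ev Es]]; have := M v Sv Ev.
by rewrite -Es ltnNge leqnSn.
Qed.

Lemma geodesic_ex x : exists2 u, geodesic S u & weval u = x.
Proof.
have [u Su ux] := raag_generated GS x.
elim: {u}(size u) {-2}u (leqnn (size u)) Su ux => [|n IH] u Hu Su ux.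
  by exists u => //; split=> // v _ _; apply: leq_trans Hu _.
have [?|/(cancels_shorten Su) [v Sv [Ev Es]]] := geodesicP Su; first by exists u.
apply: (IH v) => //; last by rewrite Ev.
by move: Hu; rewrite -Es ltnS; apply: ltnW.
Qed.

Lemma wlengthE u : geodesic S u -> wlength S (weval u) = size u.
Proof.
move=> [Su M]; rewrite /wlength; apply: xget_unique.
  split; first by exists u.
  by move=> v Sv Ev; apply: M.
move=> n [[v [Sv Ev <-]] M']; apply/eqP; rewrite eqn_leq M' //=.
exact: M.
Qed.

Lemma geodesic_size u : is_word S u -> (size u <= wlength S (weval u))%N -> geodesic S u.
Proof.
move=> Su; have [v gv Ev] := geodesic_ex (weval u).
rewrite -{1}Ev (wlengthE gv) => H; split=> // w Sw Ew.
by apply: leq_trans H _; case: gv => _; apply => //; rewrite Ev.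
Qed.

Lemma side_geodesic h x u : geodesic S u ->
  side S h (x * weval u) = side S h x (+) (wall S h \in walls S x u).
Proof.
move=> gu; rewrite side_walls ?(count_uniq_mem _ (geodesic_uniq x gu)) //; last by case: gu.
by case: (_ \in _).
Qed.

Lemma side_between h x u v : geodesic S (u ++ v) ->
  side S h x = side S h (x * weval (u ++ v)) -> side S h (x * weval u) = side S h x.
Proof.
move=> guv; have U := geodesic_uniq x guv.
have [/is_word_cat[Su Sv] _] := guv.
have := side_geodesic h x guv => ->.
rewrite side_walls //.
move: U; rewrite walls_cat cat_uniq mem_cat => /and3P[U _ _].
rewrite (count_uniq_mem _ U).
by case: (side S h x); case: (_ \in _); case: (_ \in _).
Qed.

Lemma geodesic_cat u v : is_word S (u ++ v) ->
  geodesic S u -> geodesic S v ->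
  (forall h, side S h 1 != side S h (weval u) -> side S h (weval u) = side S h (weval (u ++ v))) ->
  geodesic S (u ++ v).
Proof.
move=> Suv gu gv H; apply: (@uniq_walls_geodesic 1) => //.
rewrite walls_cat cat_uniq (geodesic_uniq _ gu) (geodesic_uniq _ gv) andbT /=.
apply/hasPn => W Wv; apply/negP => Wu; have [u1 [c [u2 [_ EW]]]] := mem_walls Wv.
have := H (c.1, base (1 * weval u * weval u1) c).
have := side_geodesic (c.1, base (1 * weval u * weval u1) c) (1 * weval u) gv.
have := side_geodesic (c.1, base (1 * weval u * weval u1) c) 1 gu.
rewrite -EW Wv Wu weval_cat -mulgA !mul1g => -> ->.
by case: (side S _ 1) => //= /(_ isT).
Qed.

(** Geodesics for [x] and [x^-1 * y] concatenate to a geodesic exactly when no wall is crossed by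
    both, so the equality of lengths becomes a condition on each wall. *)
Lemma wleP x y : wle S x y <->
  forall h, side S h 1 = side S h y -> side S h x = side S h 1.
Proof.
have [u gu Eu] := geodesic_ex x; have [v gv Ev] := geodesic_ex (x^-1 * y).
have Suv : is_word S (u ++ v) by apply/is_word_cat; case: gu; case: gv.
have Euv : weval (u ++ v) = y by rewrite weval_cat Eu Ev mulVKg.
have El : (wlength S x + wlength S (x^-1 * y))%N = size (u ++ v).
  by rewrite -Eu (wlengthE gu) Eu -Ev (wlengthE gv) size_cat.
rewrite /wle El; split=> [E h|H].
  have guv : geodesic S (u ++ v) by apply: geodesic_size => //; rewrite Euv E.
  by have := @side_between h 1 u v guv; rewrite Euv Eu !mul1g.
have guv : geodesic S (u ++ v).
  apply: geodesic_cat => // h; rewrite Eu Euv; move: (H h).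
  by case: (side S h 1); case: (side S h x); case: (side S h y) => //= /(_ erefl).
by rewrite -Euv (wlengthE guv).
Qed.

Lemma side_inj x y : (forall h, side S h x = side S h y) -> x = y.
Proof.
move=> H; have [u gu Eu] := geodesic_ex (x^-1 * y).
case: u gu Eu => [|c u] gu Eu.
  by apply: (can_inj (mulKg x^-1)); rewrite -Eu mulVg weval_nil.
have := side_geodesic (c.1, base x c) x gu.
by rewrite Eu mulVKg H /= mem_head; case: side.
Qed.

Lemma segmentP x y z : segment S x y z <->
  forall h, side S h x = side S h y -> side S h z = side S h x.
Proof.
rewrite /segment /= wleP; split=> H h.
  have := H (mv x^-1 h).
  by rewrite -(mulVg x) !side_mv.
by have := H (mv x h); rewrite !side_mvE mulVg.
Qed.

Lemma side_finite x y : exists ks : seq (G * G), forall h, side S h x != side S h y ->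
  exists2 k, k \in ks & h.1 = k.1 /\ side S h = side S k.
Proof.
have [u gu Eu] := geodesic_ex (x^-1 * y).
suff [ks Hks] : exists ks : seq (G * G), walls S x u = [seq wall S h | h <- ks].
  exists ks => h; have := side_geodesic h x gu; rewrite Eu mulVKg => -> N.
  have : wall S h \in walls S x u by move: N; case: (_ \in _); case: side.
  by rewrite Hks => /mapP[k kks [E1 E2]]; exists k.
elim: (u) (x) => [|c v IH] z; first by exists [::].
by have [ks Hks] := IH (z * letter c); exists ((c.1, base z c) :: ks); rewrite /= Hks.
Qed.

(** Pairs whose label is outside [S] are not walls: their sides are constant. They are kept as
    indices, and this degenerate case is dismissed by this lemma. *)
Lemma sep_label h x y : side S h x != side S h y -> S h.1.
Proof.
have [u gu Eu] := geodesic_ex (x^-1 * y).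
have := side_geodesic h x gu; rewrite Eu mulVKg => ->.
case E: (wall S h \in _); last by rewrite addbF eqxx.
have [u1 [c [u2 [Eu' [-> _]]]]] := mem_walls E => _.
by case: gu => Su _; apply: Su; rewrite Eu' mem_cat mem_head orbT.
Qed.

End Sides.

(** * Medians *)

Section Medians.
Implicit Types (s t g x y z : G) (h k : G * G) (u v : seq (G * bool)) (c : G * bool).

Lemma geodesic_prefix u v : geodesic S (u ++ v) -> geodesic S u.
Proof.
move=> guv; have := geodesic_uniq 1 guv; rewrite walls_cat cat_uniq => /and3P[U _ _].
by apply: uniq_walls_geodesic U; case: guv => /is_word_cat[].
Qed.

(** If the label of [k] is not in the link, [k] does not separate the coset of bases of edges of
    [h], so all these bases lie on the side of [h.2]. But two points beyond [k] that [h] separates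
    are joined by a geodesic staying beyond [k] and crossing [h]. *)
Lemma crossing_lk h k : (forall e d, exists2 x, side S h x = e & side S k x = d) ->
  lk S h.1 k.1.
Proof.
move=> Q; apply: contrapT => nlk.
have [p hp kp] := Q true (~~ side S k h.2); have [q hq kq] := Q false (~~ side S k h.2).
have [u gu Eu] := geodesic_ex (p^-1 * q).
have := side_geodesic h p gu; rewrite Eu mulVKg hp hq.
case Wu : (_ \in _) => // _; have [u1 [c [u2 [E EW]]]] := mem_walls Wu.
have Sc : S c.1 by case: gu => Su _; apply: Su; rewrite E mem_cat mem_head orbT.
have : edge S h.1 h.2 (p * weval u1) c by rewrite edgeP // -EW; case: (h).
move=> /asboolP[ch L].
have kE : side S k (base (p * weval u1) c) = side S k h.2.
  have [v [Sv Lv Ev]] := L; rewrite -(mulVKg h.2 (base _ _)) -Ev side_path //.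
  by rewrite cross_notin ?addbF // => d /Lv dlk dk; apply: nlk; rewrite -dk.
suff : side S k (base (p * weval u1) c) = side S k p.
  by rewrite kE kp; case: side.
have kpq : side S k p = side S k (p * weval u) by rewrite Eu mulVKg kp kq.
move: gu kpq; rewrite E /base; case c2: c.2 => gu kpq.
  exact: side_between gu kpq.
have -> : p * weval u1 * c.1^-1 = p * weval (u1 ++ [:: c]).
  by rewrite weval_cat weval1 mulgA /letter c2.
by move: gu kpq; rewrite -cat1s catA; apply: side_between.
Qed.

Lemma walls_split x u W1 W W2 : walls S x u = W1 ++ W :: W2 ->
  exists u1 c u2, [/\ u = u1 ++ c :: u2, W1 = walls S x u1 &
                      W = wall S (c.1, base (x * weval u1) c)].
Proof.
elim: W1 u x => [|V W1 IH] [|c u] x //= [<- Wu].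
  by exists [::], c, u; rewrite weval_nil mulg1.
have [u1 [d [u2 [-> -> ->]]]] := IH _ _ Wu; exists (c :: u1), d, u2.
by rewrite weval_cons mulgA.
Qed.

Lemma wall_letter_lk a u c : is_word S (c :: u) -> (forall d, d \in u -> lk S c.1 d.1) ->
  wall S (c.1, base (a * weval u) c) = wall S (c.1, base a c) /\
  commute (letter c) (weval u).
Proof.
move=> /is_word_cons[Sc Su] Lu; have cu : commute (letter c) (weval u).
  by apply: commute_weval => d /Lu[_ _ H]; exact: commute_letter.
split=> //; rewrite /wall /=; congr (_, _); apply: side_eq.
have L : gen S (lk S c.1) (weval u) by exists u.
rewrite /base; case: (c.2); first by rewrite mulKg.
have := commuteV (commute_sym (commute_lk L)).
by rewrite /commute -[a * _ * _]mulgA => ->; rewrite (mulgA a c.1^-1) mulKg.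
Qed.

(** If some wall separates [a] from both [x] and [y], then [a] moves across the first such wall
    towards [x]; no majority changes, since [x] and [y] agree there. If there is none, [a] itself is
    the median. *)
Lemma median_side_ex a x y :
  exists m, forall h, side S h m = maj (side S h a) (side S h x) (side S h y).
Proof.
have [u Su Eu] := raag_generated GS (a^-1 * x).
elim: {u}(size u) {-2}u (leqnn (size u)) a Su Eu => [|n IH] u0 Hu a Su0 Eu0.
  have u00 : u0 = [::] by apply: size0nil; apply/eqP; rewrite -leqn0.
  exists a => h; move: Eu0; rewrite u00 weval_nil => /(congr1 (fun z => a * z)).
  by rewrite mulg1 mulVKg => ->; rewrite /maj eqxx.
have [u gu Eu] := geodesic_ex (a^-1 * x); have [Su Mu] := gu.
have {}Hu : (size u <= n.+1)%N by apply: leq_trans Hu; apply: Mu; rewrite ?Eu.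
pose p (W : G * (G -> bool)) := W.2 a != W.2 y.
case H: (has p (walls S a u)); last first.
  exists a => h; rewrite /maj; case: eqP => // /eqP hax.
  have := side_geodesic h a gu; rewrite Eu mulVKg.
  case Wu: (_ \in _); last by move=> E; move: hax; rewrite E addbF eqxx.
  move=> _; apply/eqP/negPn; move/negP: H; apply: contra_notN => hay.
  by apply/hasP; exists (wall S h).
have [W [W1 [W2 [EW pW nW1]]]] : exists W W1 W2,
    [/\ walls S a u = W1 ++ W :: W2, p W & ~~ has p W1].
  by case: (split_find H) => W W1 W2 pW nW1; exists W, W1, W2; rewrite cat_rcons.
have [u1 [c [u2 [E EW1 EWc]]]] := walls_split EW.
have U := geodesic_uniq a gu.
have Sc : S c.1 by apply: Su; rewrite E mem_cat mem_head orbT.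
have uE : a * weval u = x by rewrite Eu mulVKg.
have hW W' : W' \in walls S a u -> W'.2 x = ~~ W'.2 a.
  move=> W'u; have [v1 [d [v2 [_ E']]]] := mem_walls W'u.
  rewrite E' /=; have := side_geodesic (d.1, base (a * weval v1) d) a gu.
  by rewrite uE -E' W'u addbT.
(* An earlier wall does not separate [a] from [y]; so [a], [z], [y], [x] occupy the four quadrants
   it forms with the wall of [c]. Hence [c] commutes with all earlier letters and can be moved to
   the front. *)
have L d : d \in u1 -> lk S c.1 d.1.
  move=> du1; have [v1 [v2 Ev]] : exists v1 v2, u1 = v1 ++ d :: v2.
    by case/splitPr: du1 => v1 v2; exists v1, v2.
  pose h := (c.1, base (a * weval u1) c); pose k := (d.1, base (a * weval v1) d).
  have kW1 : wall S k \in W1.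
    by rewrite EW1 Ev walls_cat /= mem_cat mem_head orbT.
  have hx : side S h x = ~~ side S h a.
    by have := hW W; rewrite EW mem_cat mem_head orbT EWc /= => /(_ isT).
  have kx : side S k x = ~~ side S k a.
    by have := hW (wall S k); rewrite EW mem_cat kW1 => /(_ isT).
  have hy : side S h y = ~~ side S h a.
    by move: pW; rewrite /p EWc /=; case: (side S _ a); case: (side S _ y).
  have ky : side S k y = side S k a.
    have : ~~ p (wall S k) by apply: contra nW1 => pk; apply/hasP; exists (wall S k).
    by rewrite /p negbK => /eqP.
  pose z := a * weval (v1 ++ [:: d]).
  have gz : geodesic S (v1 ++ [:: d]).
    by apply: (@geodesic_prefix _ (v2 ++ c :: u2)); rewrite -catA /= -cat_cons catA -Ev -E.
  have kz : side S k z = ~~ side S k a.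
    by rewrite /z side_geodesic // walls_cat /= mem_cat mem_head orbT addbT.
  have hz : side S h z = side S h a.
    rewrite /z side_geodesic //; case Wh: (_ \in _); last by rewrite addbF.
    have W1h : wall S h \in W1.
      rewrite EW1 Ev -cat1s catA walls_cat mem_cat Wh //.
    have W1W : W \in W1 by rewrite EWc.
    by move: U; rewrite EW cat_uniq /= W1W /= andbF.
  apply: (@crossing_lk h k) => e f.
  case: (e =P side S h a) => [->|/eqP eh]; case: (f =P side S k a) => [->|/eqP fk].
  - by exists a.
  - by exists z; rewrite ?hz ?kz //; move: fk; case: f; case: side.
  - by exists y; rewrite ?hy ?ky //; move: eh; case: e; case: side.
  - exists x; rewrite ?hx ?kx //; first by move: eh; case: e; case: side.
    by move: fk; case: f; case: side.
have Scu1 : is_word S (c :: u1).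
  apply/is_word_cons; split=> //; move: Su; rewrite E; by case/is_word_cat.
have [Ew Cw] := wall_letter_lk a Scu1 L.
have [] := IH (u1 ++ u2) _ (a * letter c).
- by move: Hu; rewrite E !size_cat /= addnS ltnS.
- move: Su; rewrite E => /is_word_cat[? /is_word_cons[_ ?]]; exact/is_word_cat.
- rewrite invgM -mulgA -Eu E !weval_cat weval_cons.
  by apply: (can_inj (mulKg (letter c))); rewrite mulVKg !mulgA Cw.
move=> m Hm; exists m => h; rewrite Hm side_edge // edgeP //.
case: eqP => [Eh|]; last by rewrite addbF; case: (h).
have hx : side S h x != side S h a.
  have := hW W; rewrite EW mem_cat mem_head orbT EWc Ew Eh; case: (h) => ? ? /= -> //.
  by case: side.
have hy : side S h y != side S h a.
  move: pW; rewrite /p EWc Ew Eh eq_sym; by case: (h).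
move: hx hy; rewrite /maj addbT.
by case: (side S h a); case: (side S h x); case: (side S h y).
Qed.

End Medians.

(** * Reduction of words and roots *)

Section Roots.
Implicit Types (s t g x y z : G) (h k : G * G) (u v : seq (G * bool)) (c : G * bool).

Definition notlk s : pred (G * bool) := fun c => ~~ `[< lk S s c.1 >].

Definition nocancel s : rel (G * bool) := fun c d => ~~ ((c.1 == s) && (d == cinv c)).

(* Local criterion: dropping the letters commuting with [s] makes every
   cancellation of [s] visible as a cancellation of neighbours. *)
Definition nocancels u := forall s, sorted (nocancel s) (filter (notlk s) u).

Lemma notlkP s c : reflect (lk S s c.1) (~~ notlk s c).
Proof. by rewrite /notlk negbK; exact: asboolP. Qed.

Lemma cancels_nocancels u : cancels u -> ~ nocancels u.
Proof.
move=> [u1 [c [u2 [u3 [-> L]]]]] /(_ c.1).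
have E2 : filter (notlk c.1) u2 = [::].
  apply/eqP; rewrite -[_ == _]negbK -has_filter; apply/hasPn => d du2.
  exact/notlkP/L.
have c1 : notlk c.1 c by apply: contraT => /notlkP[_].
have c2 : notlk c.1 (cinv c) by [].
rewrite filter_cat /= c1 filter_cat E2 /= c2 => /cat_sorted2[_] /= /andP[].
by rewrite /nocancel !eqxx.
Qed.

Lemma cancelsP u : cancels u <-> ~ nocancels u.
Proof.
split; first exact: cancels_nocancels.
move=> /existsNP[s] /negP /not_sorted_split[r1 [c [d [r2 [E]]]]].
rewrite negbK => /andP[/eqP cs /eqP dc].
have [u1 [u2 [Eu _]]] := filter_cat_split E.
move=> H2; have [v1 [v2 [Eu2 _ _ H3]]] := filter_cons_split H2.
have [w1 [w2 [Ev2 Ew1 _ _]]] := filter_cons_split H3.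
exists (u1 ++ v1), c, w1, w2; split; first by rewrite Eu Eu2 Ev2 dc catA.
move=> b bw; rewrite cs; apply/notlkP; apply/negP => nb.
have : b \in filter (notlk s) w1 by rewrite mem_filter nb.
by rewrite Ew1.
Qed.

Lemma geodesic_nocancels u : geodesic S u -> nocancels u.
Proof.
move=> gu; apply: contrapT => /cancelsP; exact: geodesic_not_cancels.
Qed.

Lemma nocancels_geodesic u : is_word S u -> nocancels u -> geodesic S u.
Proof. by move=> Su H; have [//|/cancelsP] := geodesicP Su. Qed.

(** If the square of a reduced word cancels, it does so at the seam, between a last and a first
    visible letter. Conjugating by that letter removes both, and the count of letters shows that
    putting them back around a geodesic gives a geodesic. *)
Lemma cyclic_reduction x : exists a v, [/\ geodesic S (a ++ v ++ winv a),
  weval (a ++ v ++ winv a) = x & nocancels (v ++ v)].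
Proof.
have [u gu Eu] := geodesic_ex x.
elim: {u}(size u) {-2}u x (leqnn (size u)) gu Eu => [|n IH] u x Hu gu Eu.
  have -> : x = 1 by rewrite -Eu (size0nil (s := u)) ?weval_nil //; apply/eqP; rewrite -leqn0.
  by exists [::], [::]; split=> //; rewrite ?weval_nil.
have [Su Mu] := gu.
case: (pselect (nocancels (u ++ u))) => [H|].
  by exists [::], u; rewrite /winv /= cats0.
move=> /existsNP[s] /negP; set r := filter (notlk s) u; rewrite filter_cat -/r => nrr.
have rs : sorted (nocancel s) r by apply: geodesic_nocancels.
have [c [r' Er]] : exists c r', [/\ r = cinv c :: rcons r' c & c.1 = s].
  move: nrr rs; case: r => [//|d r] nrr rs.
  case/lastP: r nrr rs => [|r c] nrr rs.
    move: nrr; rewrite /= andbT negbK => /andP[/eqP ds /eqP /(congr1 snd) /=].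
    by case: d.2.
  exists c, r; move: nrr; rewrite /= cat_path negb_and => /orP[/negP|].
    by move: rs => /= ->.
  rewrite last_rcons /= negb_and => /orP[|/negP]; last by move: rs => /= ->.
  by rewrite negbK => /andP[/eqP cs /eqP ->].
move: Er => [Er cs].
have [u1 [u2 [Eu1 E1 _ E2]]] := filter_cons_split Er.
have {}E2 : filter (notlk s) u2 = r' ++ [:: c] by rewrite E2 cats1.
have [u3 [u4 [Eu2 E3 E4]]] := filter_cat_split E2.
have [u5 [u6 [Eu4 E5 _ E6]]] := filter_cons_split E4.
have L u' : is_word S u' -> filter (notlk s) u' = [::] -> commute (letter c) (weval u').
  move=> Su' E'; apply: commute_weval => d du'; apply: commute_letter.
  rewrite cs; suff [] : lk S s d.1 by [].
  apply/notlkP; apply/negP => nd; suff : d \in filter (notlk s) u' by rewrite E'.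
  by rewrite mem_filter nd.
have Euu : u = u1 ++ cinv c :: u3 ++ u5 ++ c :: u6 by rewrite Eu1 Eu2 Eu4.
have := Su; rewrite Euu => /is_word_cat[S1] /is_word_cons[Sc] /is_word_cat[S3].
move=> /is_word_cat[S5] /is_word_cons[_ S6].
pose y := weval (u1 ++ u3 ++ u5 ++ u6).
have Ey : x = (letter c)^-1 * y * letter c.
  rewrite -Eu Euu /y !(weval_cat, weval_cons) letter_cinv.
  have H1 := commute_sym (commuteV (commute_sym (L _ S1 E1))).
  have H6 := L _ S6 E6.
  by rewrite H6 !mulgA -H1.
have [w gw Ew] := geodesic_ex y.
have Hw : ((size w).+2 <= size u)%N.
  have : (size w <= size (u1 ++ u3 ++ u5 ++ u6))%N.
    case: gw => _; apply; last by rewrite Ew.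
    by rewrite !is_word_cat.
  by rewrite Euu !size_cat /= !size_cat /= !addnS !ltnS.
have [|a [v [gav Eav Hv]]] := IH w y _ gw Ew.
  by rewrite -ltnS; apply: leq_trans Hu; apply: ltn_trans Hw.
exists (cinv c :: a), v; split=> //.
  have Ewinv : winv (cinv c :: a) = winv a ++ [:: c].
    by rewrite /winv /= rev_cons cats1 cinvK.
  apply: geodesic_size.
    rewrite Ewinv.
    have -> : (cinv c :: a) ++ v ++ winv a ++ [:: c] = cinv c :: (a ++ v ++ winv a) ++ [:: c].
      by rewrite /= -!catA.
    apply/is_word_cons; split=> //; apply/is_word_cat; split; first by case: gav.
    by apply/is_word_cons.
  rewrite Ewinv; have -> : weval ((cinv c :: a) ++ v ++ winv a ++ [:: c]) = x.
    rewrite Ey -Eav !(weval_cat, weval_cons) letter_cinv weval_nil mulg1.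
    by rewrite !mulgA.
  rewrite -Eu (wlengthE gu); apply: leq_trans Hw.
  have -> : size ((cinv c :: a) ++ v ++ winv a ++ [:: c]) = (size (a ++ v ++ winv a)).+2.
    by rewrite /= !size_cat /= !addnS addn0.
  rewrite !ltnS; case: gav => _; apply; [by case: gw|by rewrite Ew Eav].
rewrite Ey -Eav /winv /= rev_cons -cats1 cinvK !(weval_cat, weval_cons) letter_cinv weval_nil mulg1.
by rewrite !mulgA.
Qed.

(* The powers of a cyclically reduced [v] are reduced, so that [a v a^-1] and
   [a v^m a^-1] involve the same letters. *)
Lemma gen_root x m (T : set G) : gen S T (x ^+ m.+1) -> gen S T x.
Proof.
have [a [v [gav <- Hv]]] := cyclic_reduction x.
have Epow n : weval (a ++ v ++ winv a) ^+ n = weval (a ++ flatten (nseq n v) ++ winv a).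
  rewrite !weval_cat weval_winv.
  have -> : weval (flatten (nseq n v)) = weval v ^+ n.
    by elim: n => [|n IH]; rewrite ?weval_nil //= weval_cat IH expgS.
  have := conjXg (weval v) (weval a)^-1 n.
  by rewrite /conjg invgK => ->.
rewrite Epow; have [Sav _] := gav.
have SW : is_word S (a ++ flatten (nseq m.+1 v) ++ winv a).
  move: Sav => /is_word_cat[Sa /is_word_cat[Sv Sa2]].
  do 2![apply/is_word_cat; split=> //].
  by elim: (m.+1) => [//|n IH] /=; apply/is_word_cat.
have gW : geodesic S (a ++ flatten (nseq m.+1 v) ++ winv a).
  apply: nocancels_geodesic => // s.
  rewrite !filter_cat flatten_nseq_filter; apply: sorted_pump.
    by rewrite -!filter_cat; apply: geodesic_nocancels.
  by rewrite -filter_cat; apply: Hv.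
move=> /(uniq_walls_gen SW (geodesic_uniq 1 gW)) H.
exists (a ++ v ++ winv a); split=> // c; rewrite !mem_cat => H1; apply: H.
rewrite /= !mem_cat; move: H1 => /or3P[] ->; by rewrite ?orbT.
Qed.

End Roots.

(** * Walls under the powers of an element *)

Section Trichotomy.
Implicit Types (s t g w x y z a b : G) (h k : G * G) (e d : bool) (n m : nat).

Lemma wle_anti x y : wle S x y -> wle S y x -> x = y.
Proof.
move=> /wleP xy /wleP yx; apply: side_inj => h; move: (xy h) (yx h).
case: (side S h 1); case: (side S h x); case: (side S h y) => //.
all: by move=> ? /(_ erefl) || by move=> /(_ erefl).
Qed.

Lemma side_wmeet x y h :
  side S h (wmeet S x y) = maj (side S h 1) (side S h x) (side S h y).
Proof.
have [m Hm] := median_side_ex 1 x y.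
suff -> : wmeet S x y = m by [].
apply: xget_unique.
  split.
  - apply/wleP => k; rewrite Hm /maj; by case: eqP => // _ <-; case: eqP.
  - apply/wleP => k; rewrite Hm /maj; by case: eqP => // _ ->.
  - move=> t /wleP tx /wleP ty; apply/wleP => k; rewrite Hm /maj.
    by case: eqP => [E _|_ E]; [exact: tx|exact: ty].
move=> z [zx zy Hz]; apply: wle_anti.
  apply/wleP => k; rewrite Hm /maj.
  by case: eqP => [E _|_ E]; [move/wleP: zx; apply|move/wleP: zy; apply].
apply: Hz; apply/wleP => k; rewrite Hm /maj.
  by case: eqP => // _ <-; case: eqP.
by case: eqP => // _ ->.
Qed.

Lemma side_median x y z h :
  side S h (median S x y z) = maj (side S h x) (side S h y) (side S h z).
Proof.
by rewrite /median -{1}(mvVK x h) side_mv side_wmeet !side_mvE invgK mulg1 !mulVKg.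
Qed.

Lemma medianM g x y z : median S (g * x) (g * y) (g * z) = g * median S x y z.
Proof. by rewrite /median invgM -!mulgA !mulKg. Qed.

Lemma side_no_chain (F : nat -> G * G) x y :
  (forall n m, (m < n)%N -> side S (F m) <> side S (F n)) ->
  (forall n, side S (F n) x != side S (F n) y) -> False.
Proof.
move=> Fi Fs; have [ks Hks] := side_finite x y.
pose N := (size ks).+1.
suff : (N <= size ks)%N by rewrite ltnn.
rewrite -(size_iota 0 N) -(size_map (fun n => side S (F n))) -(size_map (side S)).
apply: uniq_leq_size.
  rewrite map_inj_uniq ?iota_uniq // => n m E; apply/eqP.
  by case: ltngtP => // /Fi; rewrite E.
move=> f /mapP[n _ ->]; have [k kks [_ ->]] := Hks _ (Fs n).
exact: map_f.
Qed.

Lemma side_nested h k : h.1 = k.1 ->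
  exists e d, forall x, side S h x = e -> side S k x = d -> False.
Proof.
move=> hk; apply: contrapT => H; have : lk S h.1 k.1.
  apply: crossing_lk => e d; apply: contrapT => N; apply: H; exists e, d => x hx kx.
  by apply: N; exists x.
by rewrite hk => -[].
Qed.

(* The three ways [w] can act on the translates of a wall [h]: they coincide,
   or they are nested with the side [e] attracting, or the sides [~~ e] are
   pairwise disjoint. *)
Definition type0 w h := forall x, side S h (w * x) = side S h x.

Definition typeI w h e := [/\ forall x, side S h x = e -> side S h (w * x) = e,
  forall x, exists n, side S h (w ^+ n * x) = e &
  forall x, exists n, side S h (w ^- n * x) = ~~ e].

Definition typeII w h e := forall x n, side S h x = ~~ e -> (0 < n)%N ->
  side S h (w ^+ n * x) = e /\ side S h (w ^- n * x) = e.

Lemma mono_expg w h e : (forall x, side S h x = e -> side S h (w * x) = e) ->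
  forall n x, side S h x = e -> side S h (w ^+ n * x) = e.
Proof.
move=> H; elim=> [|n IH] x hx; first by rewrite mul1g.
by rewrite expgS -mulgA; apply/H/IH.
Qed.

Lemma mono_expVg w h e : (forall x, side S h x = e -> side S h (w * x) = e) ->
  forall n x, side S h x = ~~ e -> side S h (w ^- n * x) = ~~ e.
Proof.
move=> H n x hx; case: (side S h (w ^- n * x) =P e) => [E|/eqP].
  by have := mono_expg H n E; rewrite mulVKg hx; case: (e).
by case: (side S h (w ^- n * x)); case: (e).
Qed.

(** A point [z] entering the side [e] under [w] makes the translates of the wall distinct. If some
    orbit never entered this side, or never left it backwards, infinitely many of them would
    separate two points. *)
Lemma mono_type w h e : (forall x, side S h x = e -> side S h (w * x) = e) ->
  type0 w h \/ typeI w h e.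
Proof.
move=> H; case: (pselect (type0 w h)) => [|/existsNP[z Hz]]; first by left.
have [zE wzE] : side S h z = ~~ e /\ side S h (w * z) = e.
  case: (side S h z =P e) => zE; first by case: Hz; rewrite H // zE.
  by move/eqP: zE; move/eqP: Hz; case: (side S h z); case: (side S h (w * z)); case: (e).
have P := mono_expg H; have N := mono_expVg H.
right; split=> // x; apply: contrapT => /forallNP K.
- apply: (@side_no_chain (fun n => mv (w ^- n) h) x (w * z)) => [n m mn|n].
    move=> /(congr1 (fun f => f (w ^- m * z))).
    rewrite !side_mvE !invgK mulVKg zE -(subnK mn) expgnDr expgS -!mulgA mulVKg P //.
    by case: (e).
  by rewrite !side_mvE !invgK (P n (w * z)) //; apply/eqP.
- apply: (@side_no_chain (fun n => mv (w ^+ n) h) x z) => [n m mn|n].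
    move=> /(congr1 (fun f => f (w ^+ m * (w * z)))).
    rewrite !side_mvE mulKg wzE -(subnKC mn) expgnDr invgM.
    rewrite (mulgA (w ^+ m)) -expgSr -mulgA mulKg N //.
    by case: (e).
  by rewrite !side_mvE (N n z) //; apply/eqP.
Qed.

(** Fixing the wall [(s, g)] means that the conjugate by [g] lies in the subgroup of the link of
    [s], and [gen_root] extracts roots there. *)
Lemma type0_root w h n : type0 (w ^+ n.+1) h -> type0 w h.
Proof.
case: (pselect (S h.1)) => [Sh|nSh] T0 x; last first.
  by apply/eqP/negPn/negP => /sep_label.
have E : side S (mv (w ^- n.+1) h) = side S h.
  by apply/funext => y; rewrite side_mvE invgK T0.
have L : gen S (lk S h.1) (h.2^-1 * (w ^- n.+1 * h.2)).
  have : edge S h.1 h.2 (w ^- n.+1 * h.2) (h.1, true).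
    by rewrite edgeP //= /base /=; move: E; rewrite /wall /mv /= => ->; case: (h).
  by move=> /asboolP[].
have {}L : gen S (lk S h.1) (h.2^-1 * (w^-1 * h.2)).
  by apply: (@gen_root _ n); move: L; rewrite -expVgn -!conjgE conjXg.
have := side_eq L; have -> : (h.1, w^-1 * h.2) = mv w^-1 h by [].
rewrite -surjective_pairing => E2.
by rewrite -[in RHS]E2 side_mvE invgK.
Qed.

Lemma type0X w h n x : type0 w h -> side S h (w ^+ n * x) = side S h x.
Proof.
by move=> T; elim: n => [|n IH]; rewrite ?mul1g // expgS -mulgA T.
Qed.

Lemma type0V w h : type0 w h -> type0 w^-1 h.
Proof. by move=> T x; rewrite -{2}(mulVKg w x) T. Qed.

(* An inclusion between two translates of the side [~~ e] would put some point
   in two consecutive translates, by monotonicity. *)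
Lemma disjoint_typeII w h e : ~ type0 w h ->
  (forall x, side S h x = ~~ e -> side S h (w * x) = e) -> typeII w h e.
Proof.
move=> nT0 D.
have nomono n d : (forall x, side S h x = d -> side S h (w ^+ n.+1 * x) = d) -> False.
  move=> M; have [/type0_root //|[_ Mp Mn]] := mono_type M.
  (* Suitable powers of [w ^+ n.+1] bring both 1 and [w] to the side [~~ e]; by monotonicity a
     common power does, and it commutes with [w]. *)
  have [x0 x0E] : exists x, side S h x = ~~ e /\ side S h (w * x) = ~~ e.
    have P := mono_expg M; have N := mono_expVg M.
    case: (d =P e) => [de|/eqP de].
      have [p Hp] := Mn w; have [q Hq] := Mn 1.
      have p' := N q _ Hp; have q' := N p _ Hq.
      exists ((w ^+ n.+1) ^- p * (w ^+ n.+1) ^- q); rewrite -de; split.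
        by move: q'; rewrite mulg1.
      move: p'; rewrite !mulgA; congr (side S h _ = _).
      have C : commute w ((w ^+ n.+1) ^- q * (w ^+ n.+1) ^- p).
        by apply: commuteM; apply: commuteV; do 2!apply: commuteX.
      rewrite -C -mulgA; congr (_ * _).
      by rewrite -!invgM -!expgnDr addnC.
    have [p Hp] := Mp w; have [q Hq] := Mp 1.
    have p' := P q _ Hp; have q' := P p _ Hq.
    have dE : d = ~~ e by move: de; case: (d); case: (e).
    exists ((w ^+ n.+1) ^+ p * (w ^+ n.+1) ^+ q); rewrite -dE; split.
      by move: q'; rewrite mulg1.
    move: p'; rewrite !mulgA; congr (side S h _ = _).
    have C : commute w ((w ^+ n.+1) ^+ q * (w ^+ n.+1) ^+ p).
      by apply: commuteM; do 2!apply: commuteX.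
    rewrite -C -mulgA; congr (_ * _).
    by rewrite -!expgnDr addnC.
  by have [/D ->] := x0E; case: (e).
have K n x : side S h x = ~~ e -> side S h (w ^+ n.+1 * x) = e.
  case: n => [|n] xE; first by rewrite expg1 D.
  case E: (side S h (w ^+ n.+2 * x) == e); first exact/eqP.
  have {E} wxE : side S h (w ^+ n.+2 * x) = ~~ e.
    by move: E; case: (side S h (_ * x)); case: (e).
  have [e1 [e2 H]] := @side_nested h (mv (w ^- n.+2) h) erefl.
  have {}H y : side S h y = e1 -> side S h (w ^+ n.+2 * y) = ~~ e2.
    move=> /H; rewrite side_mvE invgK.
    by case: (side S h (_ * y)); case: (e2) => //= /(_ erefl).
  case: (e1 =P ~~ e2) => e12; first by exfalso; apply: (@nomono n.+1 e1) => y /H ->.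
  case: (e1 =P ~~ e) => e1e.
    by move: (H x) e12; rewrite xE wxE -e1e => /(_ erefl) <-.
  (* In this last case [w ^+ n.+2] sends the side [e] into [~~ e], while [w] sends [~~ e] into [e];
     so [w ^+ n.+3] would preserve [~~ e]. *)
  exfalso; apply: (@nomono n.+2 (~~ e)) => y yE.
  rewrite expgSr -mulgA H.
    by move: e12 e1e; case: (e1); case: (e2); case: (e).
  by rewrite D //; move: e1e; case: (e1); case: (e).
move=> x [//|n] xE _; split; first exact: K.
case E: (side S h (w ^- n.+1 * x) == e); first exact/eqP.
have := K n (w ^- n.+1 * x); rewrite mulVKg xE.
move: E; case: (side S h (_ * x)); case: (e) => //= _ /(_ erefl) //.
Qed.

(** The wall and its translate have one label, so a quadrant is empty; two of the four possibilities
    give monotonicity, the other two disjointness. *)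
Lemma trichotomy w h : [\/ type0 w h, exists e, typeI w h e | exists e, typeII w h e].
Proof.
case: (pselect (type0 w h)) => [|nT0]; first by constructor 1.
have [e1 [e2 H]] := @side_nested h (mv w^-1 h) erefl.
have {}H y : side S h y = e1 -> side S h (w * y) = ~~ e2.
  move=> /H; rewrite side_mvE invgK.
  by case: (side S h (_ * y)); case: (e2) => //= /(_ erefl).
case: (e1 =P ~~ e2) => e12.
  constructor 2; exists e1; have [|//|//] := @mono_type w h e1.
  by move=> x /H ->.
constructor 3; exists (~~ e2); apply: disjoint_typeII => // x xE; apply: H.
by rewrite xE; move: e12; case: (e1); case: (e2).
Qed.

End Trichotomy.

(** * Limits of orbits; coordinates of phi_w and X_w *)

Section Limits.
Implicit Types (s t g w x y z a b c : G) (h k : G * G) (e d : bool) (n m : nat).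

Lemma commute_conjg g w : commute g w -> w ^ g = w.
Proof. by move=> gw; rewrite conjgE -gw mulKg. Qed.

Lemma side_conj h w a x : side S h (w ^ a * x) = side S (mv a h) (w * (a * x)).
Proof. by rewrite side_mvE conjgE -!mulgA. Qed.

Lemma typeI_conj w a h e : typeI (w ^ a) h e <-> typeI w (mv a h) e.
Proof.
have H w' a' h' : typeI w' (mv a' h') e -> typeI (w' ^ a') h' e.
  move=> [T1 T2 T3]; split=> x; first by rewrite side_conj => xe; apply: T1; rewrite side_mv.
  - by have [n Hn] := T2 (a' * x); exists n; rewrite -conjXg side_conj.
  - by have [n Hn] := T3 (a' * x); exists n; rewrite -conjXg -conjVg side_conj.
split; last exact: H.
by rewrite -{1}(mvK a h) => /H; rewrite conjgK.
Qed.

Lemma typeII_conj w a h e : typeII (w ^ a) h e <-> typeII w (mv a h) e.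
Proof.
have H w' a' h' : typeII w' (mv a' h') e -> typeII (w' ^ a') h' e.
  move=> T x n xe n0; rewrite -conjXg -conjVg !side_conj; apply: T => //.
  by rewrite side_mv.
split; last exact: H.
by rewrite -{1}(mvK a h) => /H; rewrite conjgK.
Qed.

Lemma typeI_V w h e : typeI w h e -> typeI w^-1 h (~~ e).
Proof.
move=> [T1 T2 T3]; split=> x.
- by move=> xe; have := mono_expVg T1 1%N xe; rewrite expg1.
- by have [n Hn] := T3 x; exists n; rewrite expVgn.
- by have [n Hn] := T2 x; exists n; rewrite expVgn invgK negbK.
Qed.

(** A coordinate of the point at infinity of the orbit. By [lim_ev] every orbit finally stays on one
    side, so [false] does mean finally [false]. *)
Definition lim w x h : bool :=
  `[< exists n, forall m, (n <= m)%N -> side S h (w ^+ m * x) >].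

Lemma lim_eq w x h e n : (forall m, (n <= m)%N -> side S h (w ^+ m * x) = e) ->
  lim w x h = e.
Proof.
case: e => H; first by apply/asboolP; exists n => m /H.
apply/negP => /asboolP[p /(_ _ (leq_maxr n p))].
by rewrite H ?leq_maxl.
Qed.

Lemma lim_type0 w x h : type0 w h -> lim w x h = side S h x.
Proof. by move=> T; apply: (@lim_eq _ _ _ _ 0) => m _; exact: type0X. Qed.

Lemma typeI_ev w x h e : typeI w h e ->
  exists n, forall m, (n <= m)%N -> side S h (w ^+ m * x) = e.
Proof.
move=> [T1 T2 T3]; have [n Hn] := T2 x; exists n => m nm.
by rewrite -(subnK nm) expgnDr -mulgA; apply: mono_expg.
Qed.

(** The translates of the side [~~ e] being disjoint, an orbit visits it at most once. *)
Lemma typeII_ev w x h e : typeII w h e ->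
  exists n, forall m, (n <= m)%N -> side S h (w ^+ m * x) = e.
Proof.
move=> T; case: (pselect (exists n, side S h (w ^+ n * x) = ~~ e)) => [[n Hn]|/forallNP H].
  exists n.+1 => m nm; have [] := T _ (m - n)%N Hn; first by rewrite subn_gt0.
  by rewrite mulgA -expgnDr subnK // ltnW.
exists 0 => m _; have := H m; case: (side S h _); case: (e) => //.
Qed.

Lemma lim_typeI w x h e : typeI w h e -> lim w x h = e.
Proof. by move=> /(typeI_ev x)[n Hn]; apply: lim_eq Hn. Qed.

Lemma lim_typeII w x h e : typeII w h e -> lim w x h = e.
Proof. by move=> /(typeII_ev x)[n Hn]; apply: lim_eq Hn. Qed.

Lemma lim_ev w x h : exists n, forall m, (n <= m)%N -> side S h (w ^+ m * x) = lim w x h.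
Proof.
have [T|[e T]|[e T]] := trichotomy w h.
- by exists 0 => m _; rewrite lim_type0 // type0X.
- by rewrite (lim_typeI x T); exact: typeI_ev.
- by rewrite (lim_typeII x T); exact: typeII_ev.
Qed.

Lemma lim_side w x h k : side S h = side S k -> lim w x h = lim w x k.
Proof. by rewrite /lim => ->. Qed.

(** One exponent serves for all the walls between two points, by finiteness. *)
Lemma lim_unif w x y z : exists n, forall m h, (n <= m)%N -> side S h y != side S h z ->
  side S h (w ^+ m * x) = lim w x h.
Proof.
have [ks Hks] := side_finite y z.
suff [n Hn] : exists n, forall m k, (n <= m)%N -> k \in ks -> side S k (w ^+ m * x) = lim w x k.
  exists n => m h nm /Hks[k kks [_ E]].
  by rewrite E (lim_side _ _ E) Hn.
elim: ks {Hks} => [|k ks [n IH]]; first by exists 0.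
have [p Hp] := lim_ev w x k; exists (maxn n p) => m k' nm.
rewrite inE => /orP[/eqP ->|]; first by apply: Hp; apply: leq_trans nm; apply: leq_maxr.
by apply: IH; apply: leq_trans nm; apply: leq_maxl.
Qed.

Lemma limM w x h : lim w (w * x) h = lim w x h.
Proof.
have [n Hn] := lim_ev w x h; apply: (@lim_eq _ _ _ _ n) => m nm.
by rewrite mulgA -expgSr Hn // ltnW.
Qed.

Lemma lim_mvV w x h : lim w x (mv w^-1 h) = lim w x h.
Proof.
have [n Hn] := lim_ev w x h; apply: (@lim_eq _ _ _ _ n) => m nm.
by rewrite side_mvE invgK mulgA -expgS Hn // ltnW.
Qed.

Lemma lim_mv w x h : lim w x (mv w h) = lim w x h.
Proof. by rewrite -{2}(mvK w h) lim_mvV. Qed.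

Lemma lim_conj w a x h : lim (w ^ a) x h = lim w (a * x) (mv a h).
Proof.
have [n Hn] := lim_ev w (a * x) (mv a h); apply: (@lim_eq _ _ _ _ n) => m nm.
by rewrite -conjXg side_conj Hn.
Qed.

Lemma side_phi w x h :
  side S h (phi S w x) = maj (side S h (w * x)) (side S h x) (side S h (w^-1 * x)).
Proof. exact: side_median. Qed.

(** At most one of [w * x], [x] and [w^-1 * x] can lie on the side [~~ e]. *)
Lemma phi_typeII w x h e : typeII w h e -> side S h (phi S w x) = e.
Proof.
move=> T; rewrite side_phi /maj.
case: (side S h x =P e) => xE; case: (side S h (w * x) =P e) => wxE.
- by rewrite wxE xE eqxx.
- have {}wxE : side S h (w * x) = ~~ e by move: wxE; case: side; case: (e).
  have [_] := T _ 2%N wxE isT; rewrite expg2 invgM -mulgA mulKg => ->.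
  by rewrite wxE xE; case: (e).
- have {}xE : side S h x = ~~ e by move: xE; case: side; case: (e).
  have [_] := T _ 1%N xE isT; rewrite expg1 => ->.
  by rewrite wxE xE; case: (e).
- have {}xE : side S h x = ~~ e by move: xE; case: side; case: (e).
  by have [] := T _ 1%N xE isT; rewrite expg1.
Qed.

Lemma phi_type0 w x h : type0 w h -> side S h (phi S w x) = side S h x.
Proof. by move=> T; rewrite side_phi /maj T eqxx. Qed.

Lemma phi_typeI w x h e : typeI w h e -> side S h (phi S w x) = side S h x.
Proof.
move=> [T _ _]; rewrite side_phi /maj.
case: (side S h x =P e) => xE; first by rewrite (T _ xE) xE eqxx.
have {}xE : side S h x = ~~ e by move: xE; case: side; case: (e).
by have := mono_expVg T 1%N xE; rewrite expg1 => ->; rewrite xE; case: eqP.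
Qed.

(** Only the coordinates at walls of [typeII] are altered by [phi S w], and there its value is
    prescribed; so its image is an intersection of half-spaces and consists of fixed points. *)
Lemma XsetP w x : Xset S w x <-> forall h e, typeII w h e -> side S h x = e.
Proof.
split=> [[y _ <-] h e T|H]; first exact: phi_typeII.
exists x => //; apply: side_inj => h.
have [T|[e T]|[e T]] := trichotomy w h.
- exact: phi_type0.
- exact: phi_typeI T.
- by rewrite (phi_typeII x T) (H _ _ T).
Qed.

Lemma Xset_phi w x : Xset S w (phi S w x).
Proof. by exists x. Qed.

Lemma Xset_phi_id w x : Xset S w x -> phi S w x = x.
Proof.
move=> /XsetP H; apply: side_inj => h.
have [T|[e T]|[e T]] := trichotomy w h.
- exact: phi_type0.
- exact: phi_typeI T.
- by rewrite (phi_typeII x T) (H _ _ T).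
Qed.

(** This says that [x] lies between [w^-1 * x] and [w * x]: a test that needs no knowledge of the
    types of the walls. *)
Lemma XsetP2 w x : Xset S w x <->
  forall h, side S h (w * x) = side S h (w^-1 * x) -> side S h x = side S h (w * x).
Proof.
split=> [Xx h E|H].
  by rewrite -{1}(Xset_phi_id Xx) side_phi /maj -E; case: eqP.
apply/XsetP => h e T; case: (side S h x =P e) => // xE.
have {}xE : side S h x = ~~ e by move: xE; case: side; case: (e).
have [] := T _ 1%N xE isT; rewrite expg1 => E1 E2.
by move: (H h); rewrite E1 E2 xE => /(_ erefl).
Qed.

Lemma Xset_conj w a x : Xset S (w ^ a) x <-> Xset S w (a * x).
Proof.
rewrite !XsetP; split=> H h e T.
  by rewrite -(mvVK a h) side_mv; apply: H; rewrite typeII_conj mvVK.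
by rewrite -(side_mv a); apply: H; apply/typeII_conj.
Qed.

Lemma Xset_commute w g x : commute g w -> Xset S w (g * x) <-> Xset S w x.
Proof. by move=> gw; rewrite -Xset_conj commute_conjg. Qed.

Definition crosses w h : Prop := exists e, typeI w h e.

(** The side of the attracting end. For a crossed wall the base point 1 is immaterial; for a wall
    fixed by [w] this is merely the side of 1. *)
Definition eps w h : bool := lim w 1 h.

Lemma crosses_eps w h : crosses w h -> typeI w h (eps w h).
Proof. by move=> [e T]; rewrite /eps (lim_typeI _ T). Qed.

Lemma lim_crosses w x h : crosses w h -> lim w x h = eps w h.
Proof. by move=> /crosses_eps; apply: lim_typeI. Qed.

Lemma crosses_conj w a h : crosses (w ^ a) h <-> crosses w (mv a h).
Proof. by split=> -[e /typeI_conj T]; exists e => //; apply/typeI_conj. Qed.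

Lemma crosses_side w h k : side S h = side S k -> crosses w h -> crosses w k.
Proof. by move=> E [e]; rewrite /typeI E => T; exists e. Qed.

Lemma eps_side w h k : side S h = side S k -> eps w h = eps w k.
Proof. exact: lim_side. Qed.

Lemma crosses_commute w g h : commute g w -> crosses w (mv g h) <-> crosses w h.
Proof. by move=> gw; rewrite -crosses_conj commute_conjg. Qed.

Lemma eps_commute w g h : commute g w -> crosses w h -> eps w (mv g h) = eps w h.
Proof.
move=> gw wh; rewrite -(lim_crosses (g * 1)); last exact/crosses_commute.
by rewrite -lim_conj commute_conjg.
Qed.

End Limits.

(** * Coordinates of X_(w,a), Psi_(w,a), bullet_w and vee_(w;a) *)

Section Axes.
Implicit Types (s t g w x y z a b c : G) (h k : G * G) (e d : bool) (n m : nat).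

Lemma neq_negb d e : d <> e -> d = ~~ e.
Proof. by case: d; case: e. Qed.

Lemma expgz_commute w (n : int) : commute (expgz w n) w.
Proof.
case: n => n /=; apply: commute_sym; first exact: commuteX.
exact/commuteV/commuteX.
Qed.

Lemma expgzN w n : expgz w (- Posz n)%R = w ^- n.
Proof. by case: n => //=; rewrite invg1. Qed.

Lemma side_expgz w (n : int) b h : Xset S w b -> ~ crosses w h ->
  side S h (expgz w n * b) = side S h b.
Proof.
move=> Xb nc; have [T|[e T]|[e T]] := trichotomy w h.
- case: n => n /=; first exact: type0X.
  by rewrite -expVgn; apply: type0X; apply: type0V.
- by case: nc; exists e.
- have Xnb : Xset S w (expgz w n * b) by apply/(Xset_commute b (expgz_commute w n)).
  by move/XsetP: Xb => /(_ _ _ T) ->; move/XsetP: Xnb => /(_ _ _ T) ->.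
Qed.

Lemma crosses_reach w b x y : Xset S w b -> exists n, forall h, crosses w h ->
  side S h x != side S h y ->
  side S h (w ^+ n * b) = eps w h /\ side S h (w ^- n * b) = ~~ eps w h.
Proof.
move=> Xb; have [p Hp] := lim_unif w b x y; have [q Hq] := lim_unif w^-1 b x y.
exists (maxn p q) => h wh hxy; have T := crosses_eps wh.
rewrite (Hp _ _ (leq_maxl p q) hxy) (lim_typeI _ T) -expVgn.
by rewrite (Hq _ _ (leq_maxr p q) hxy) (lim_typeI _ (typeI_V T)).
Qed.

Definition in_axis w b x : Prop := forall h, ~ crosses w h -> side S h x = side S h b.

(** The walls between [x] and [b] are crossed and finite in number, so for large [n] they all
    separate [w ^- n * b] from [w ^+ n * b]. *)
Lemma axis_segment w b x : Xset S w b -> in_axis w b x ->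
  exists n, segment S (w ^- n * b) (w ^+ n * b) x.
Proof.
move=> Xb Cx; have [n Hn] := crosses_reach x b Xb; exists n; apply/segmentP => h.
case: (pselect (crosses w h)) => wh; last first.
  rewrite (Cx _ wh); have := side_expgz (Posz n) Xb wh => /= ->.
  by have := side_expgz (- (Posz n))%R Xb wh; rewrite expgzN => ->.
have [T1 _ _] := crosses_eps wh; have [xb|/eqP xb] := side S h x =P side S h b; last first.
  by have [-> ->] := Hn _ wh xb; case: eps.
rewrite xb; case: (side S h b =P eps w h) => bE.
  by rewrite (mono_expg T1 n bE) bE => ->.
by have bE' := neq_negb bE; rewrite (mono_expVg T1 n bE') bE'.
Qed.

Lemma XaxisP w b x : Xset S w b -> Xaxis S w b x <-> in_axis w b x.
Proof.
move=> Xb; split.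
  apply; split=> [y z Cy Cz c /segmentP yzc h wh|y [n _ <-] h wh].
    by rewrite yzc ?Cy // Cz.
  exact: side_expgz.
move=> /(axis_segment Xb)[n xn] M [cM wM]; apply: cM xn; apply: wM.
  by exists (- (Posz n))%R; rewrite ?expgzN.
by exists (Posz n).
Qed.

(** These coordinates are realized by the median of [x] and two far points of the orbit of [b]: off
    the crossed walls both far points vote as [b]; on a crossed wall at least one votes as [x], for
    large [n]. *)
Lemma Psi_spec w b x : Xset S w b -> in_axis w b (Psi S w b x) /\
  forall h, crosses w h -> side S h (Psi S w b x) = side S h x.
Proof.
move=> Xb; have [n Hn] := crosses_reach x b Xb.
pose d := median S x (w ^- n * b) (w ^+ n * b).
have dC : in_axis w b d.
  move=> h wh; rewrite /d side_median.
  have := side_expgz (Posz n) Xb wh => /= ->.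
  have := side_expgz (- (Posz n))%R Xb wh.
  by rewrite expgzN => ->; rewrite /maj; case: eqP.
have dx h : crosses w h -> side S h d = side S h x.
  move=> wh; rewrite /d side_median /maj.
  have [T1 _ _] := crosses_eps wh; have [xb|/eqP xb] := side S h x =P side S h b; last first.
    have [-> ->] := Hn _ wh xb; case: eqP => //.
    by case: side; case: eps.
  rewrite xb; case: (side S h b =P eps w h) => bE.
    by rewrite (mono_expg T1 n bE) bE; case: eqP.
  by have bE' := neq_negb bE; rewrite (mono_expVg T1 n bE') bE' eqxx.
suff -> : Psi S w b x = d by [].
have seg c : in_axis w b c -> segment S x c d.
  move=> Cc; apply/segmentP => h xc; case: (pselect (crosses w h)) => wh; first exact: dx.
  by rewrite dC // -(Cc _ wh).
apply: xget_unique; first by split=> [|c /(XaxisP _ Xb)]; [exact/(XaxisP _ Xb)|exact: seg].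
move=> c [/(XaxisP _ Xb) Cc Hc]; apply: side_inj => h.
have /segmentP xcd := seg _ Cc; have /(XaxisP _ Xb)/Hc/segmentP xdc := dC.
move: (xcd h) (xdc h).
case: (side S h x); case: (side S h c); case: (side S h d) => //.
all: by move=> /(_ erefl) || by move=> _ /(_ erefl).
Qed.

(** Translating the hypothesis puts [w ^+ n * z] between [w ^+ n * y] and [w ^+ n.+1 * z]. When the
    orbit of [z] changes side at that step, [w ^+ n * y] has to be on the old side. *)
Lemma preceq_iter w y z n h e : preceq S w y z -> side S h z = ~~ e ->
  side S h (w ^+ n * z) = e -> exists m, side S h (w ^+ m * y) = ~~ e.
Proof.
move=> /segmentP P zE; elim: n => [|n IH]; first by rewrite mul1g zE; case: (e).
case: (side S h (w ^+ n * z) =P e) => [/IH //|/neq_negb wz] swz.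
exists n; have := P (mv (w ^- n) h); rewrite !side_mvE !invgK wz mulgA -expgSr swz.
by case: (side S h _); case: (e) => // /(_ erefl).
Qed.

(** One coordinate of the conditions [preceq] for the bullet: [u] and [v] are the sides of [w * x]
    and [w * y], and [e] is the limit, which [w] does not change. *)
Lemma maj_mono (x y u v e : bool) : (x = e -> u = e) -> (y = e -> v = e) ->
  (x = maj u v e -> maj x y e = x) /\ (y = maj u v e -> maj x y e = y).
Proof.
by case: x; case: y; case: u; case: v; case: e; rewrite /maj /= => A B; split=> //;
  first [have := A erefl | have := B erefl].
Qed.

Lemma maj_disjoint (x y u v e : bool) : (x = ~~ e -> u = e) -> (y = ~~ e -> v = e) ->
  (x = maj u v e -> maj x y e = x) /\ (y = maj u v e -> maj x y e = y).
Proof.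
by case: x; case: y; case: u; case: v; case: e; rewrite /maj /= => A B; split=> //;
  first [have := A erefl | have := B erefl].
Qed.

(** The median of [x], [y] and the limit of the orbit of [x], the limit being replaced by a point
    good for all walls between [x] and [y]. If an element of [Uset] stayed with [x] on the repelling
    side of a crossed wall while [y] is on the attracting one, [preceq_iter] would bring the orbit
    of [y] back. *)
Lemma side_bullet w x y h :
  side S h (bullet S w x y) = maj (side S h x) (side S h y) (lim w x h).
Proof.
have [n Hn] := lim_unif w x x y.
pose c := median S x y (w ^+ n * x).
have cE k : side S k c = maj (side S k x) (side S k y) (lim w x k).
  rewrite /c side_median /maj; case: eqP => // /eqP xy.
  exact: Hn.
suff -> : bullet S w x y = c by [].
have Uc : Uset S w x y c.
  split.
  - by apply/segmentP => k; rewrite cE /maj => ->; rewrite eqxx.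
  - apply/segmentP => k; have := cE (mv w^-1 k); rewrite !side_mvE !invgK lim_mvV cE => ->.
    have [T|[e T]|[e T]] := trichotomy w k.
    + by rewrite (lim_type0 _ T) !T /maj; case: eqP.
    + have [T1 _ _] := T; rewrite (lim_typeI _ T).
      by apply: (proj1 (@maj_mono _ _ _ _ _ _ _)); exact: T1.
    + rewrite (lim_typeII _ T).
      by apply: (proj1 (@maj_disjoint _ _ _ _ _ _ _)) => E; have [] := T _ 1%N E isT.
  - apply/segmentP => k; have := cE (mv w^-1 k); rewrite !side_mvE !invgK lim_mvV cE => ->.
    have [T|[e T]|[e T]] := trichotomy w k.
    + rewrite (lim_type0 _ T) !T /maj; case: (side S k x); by case: (side S k y).
    + have [T1 _ _] := T; rewrite (lim_typeI _ T).
      by apply: (proj2 (@maj_mono _ _ _ _ _ _ _)); exact: T1.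
    + rewrite (lim_typeII _ T).
      by apply: (proj2 (@maj_disjoint _ _ _ _ _ _ _)) => E; have [] := T _ 1%N E isT.
have Mc z : Uset S w x y z -> segment S x z c.
  move=> [/segmentP xyz _ yz]; apply/segmentP => k xz; rewrite cE /maj.
  case: eqP => // xy; have [T|[e T]|[e T]] := trichotomy w k.
  - by rewrite (lim_type0 _ T).
  - rewrite (lim_typeI _ T); case: (side S k x =P e) => // /neq_negb xE.
    have yE : side S k y = e by move: xy; rewrite xE; case: side; case: (e).
    have [T1 T2 _] := T; have [m Hm] := T2 z.
    have zE : side S k z = ~~ e by rewrite -xz.
    have [p] := preceq_iter yz zE Hm.
    by rewrite (mono_expg T1 p yE); case: (e).
  - rewrite (lim_typeII _ T); case: (side S k x =P e) => // /neq_negb xE.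
    have yE : side S k y = e by move: xy; rewrite xE; case: side; case: (e).
    have zE : side S k z = ~~ e by rewrite -xz.
    have [wzE _] := T z 1%N zE isT.
    move/segmentP: yz => /(_ k); rewrite -{1}(expg1 w) wzE yE zE => /(_ erefl).
    by case: (e).
apply: xget_unique => // c' [Uc' Mc']; apply: side_inj => k.
have /segmentP xcd := Mc _ Uc'; have /segmentP xdc := Mc' _ Uc.
move: (xcd k) (xdc k).
case: (side S k x); case: (side S k c); case: (side S k c') => //.
all: by move=> /(_ erefl) || by move=> _ /(_ erefl).
Qed.

(** On walls fixed by [w] the two bullets keep the sides of [x] and [y], and [a] decides; on all
    other walls the two bullets agree. *)
Lemma side_vee w a x y h :
  side S h (vee S w a x y) = maj (side S h x) (side S h y) (lim w a h).
Proof.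
rewrite /vee side_median !side_bullet.
have [T|[e T]|[e T]] := trichotomy w h.
- rewrite !(lim_type0 _ T) /maj.
  by case: (side S h x); case: (side S h y); case: (side S h a).
- rewrite !(lim_typeI _ T) /maj.
  by case: (side S h x); case: (side S h y); case: (side S h a); case: (e).
- rewrite !(lim_typeII _ T) /maj.
  by case: (side S h x); case: (side S h y); case: (side S h a); case: (e).
Qed.

End Axes.

(** * Signed translation lengths *)

Section Shifts.
Implicit Types (s t g w x y z a b : G) (h k : G * G) (e d : bool) (n m : nat).
Implicit Types (u v : seq (G * bool)) (c : G * bool).

Lemma crosses_ends w h k x : crosses w h -> crosses w k ->
  (exists y, side S h y = eps w h /\ side S k y = eps w k) /\
  (exists y, side S h y = ~~ eps w h /\ side S k y = ~~ eps w k).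
Proof.
move=> /crosses_eps Th /crosses_eps Tk; split.
  have [n Hn] := typeI_ev x Th; have [m Hm] := typeI_ev x Tk.
  by exists (w ^+ (maxn n m) * x); rewrite Hn ?leq_maxl // Hm ?leq_maxr.
have [n Hn] := typeI_ev x (typeI_V Th); have [m Hm] := typeI_ev x (typeI_V Tk).
by exists (w^-1 ^+ (maxn n m) * x); rewrite Hn ?leq_maxl // Hm ?leq_maxr.
Qed.

(** Otherwise [x] and [y] would occupy the two mixed quadrants, far points of the axes the other
    two, and walls with one label would cross. So crossed walls of one label between two points are
    all traversed in the same sense. *)
Lemma crosses_chain w h k x y : crosses w h -> crosses w k -> h.1 = k.1 ->
  side S h x = ~~ eps w h -> side S h y = eps w h ->
  side S k x = eps w k -> side S k y = eps w k.
Proof.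
move=> wh wk hk hx hy kx; case: (side S k y =P eps w k) => // /neq_negb ky.
have [[z1 [hz1 kz1]] [z2 [hz2 kz2]]] := crosses_ends x wh wk.
have [e [d H]] := side_nested hk; exfalso.
case: (e =P eps w h) => eh; case: (d =P eps w k) => dk.
- by apply: (H z1); rewrite ?eh ?dk.
- by apply: (H y); rewrite ?eh ?(neq_negb dk).
- by apply: (H x); rewrite ?(neq_negb eh) ?dk.
- by apply: (H z2); rewrite ?(neq_negb eh) ?(neq_negb dk).
Qed.

Definition step w s x c : int :=
  if (c.1 == s) && `[< crosses w (c.1, base x c) >] then
    if c.2 == eps w (c.1, base x c) then 1%R else (-1)%R
  else 0%R.

Fixpoint ssum w s x u : int :=
  if u is c :: u' then (step w s x c + ssum w s (x * letter c) u')%R else 0%R.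

(* Signed number of walls with label [s] crossed by the axes of [w] that
   separate [x] from [y], counted positively when [y] is on the side of the
   attracting end. *)
Definition shift w s x y : int := ssum w s x (word S (x^-1 * y)).

Lemma ssum_cat w s x u v : ssum w s x (u ++ v) = (ssum w s x u + ssum w s (x * weval u) v)%R.
Proof.
elim: u x => [|c u IH] x; first by rewrite weval_nil mulg1 add0r.
by rewrite /= IH weval_cons mulgA addrA.
Qed.

Lemma base_cinv x c : base (x * letter c) (cinv c) = base x c.
Proof. by case: c => t []; rewrite /base /letter /= ?mulgK. Qed.

Lemma step_cinv w s x c : step w s (x * letter c) (cinv c) = (- step w s x c)%R.
Proof.
rewrite /step base_cinv /=; case: (_ && _); last by rewrite oppr0.
by case: c.2; case: eps => //=; rewrite opprK.
Qed.

Lemma crosses_sideE w h k : side S h = side S k -> `[< crosses w h >] = `[< crosses w k >].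
Proof. by move=> E; apply: asbool_equiv_eq; split; apply: crosses_side. Qed.

Lemma step_lk w s x c t : lk S t c.1 -> step w s (x * letter c) (t, true) = step w s x (t, true).
Proof.
move=> L; have E : side S (t, x * letter c) = side S (t, x).
  apply: side_eq; rewrite mulKg; exists [:: c]; split=> [d|d|]; last exact: weval1.
    by rewrite inE => /eqP->; case: L.
  by rewrite inE => /eqP->.
by rewrite /step /base /= (crosses_sideE w E) (eps_side w E).
Qed.

Lemma ssum_equiv w s x u v : word_equiv S u v -> ssum w s x u = ssum w s x v.
Proof.
move=> E; elim: E x => {u v}
  [//|u v _ E x|u v r _ E1 _ E2 x|a b u v E IH x|t e St x|t t' St St' tt' ct x].
- by rewrite E.
- by rewrite E1 E2.
- by rewrite !ssum_cat IH (word_equiv_weval E).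
- by rewrite /= (step_cinv w s x (t, e)) addr0 addrN.
- rewrite /= !addr0.
  have L1 : lk S t (t', true).1 by split=> //; exact: nesym.
  have L2 : lk S t' (t, true).1 by split=> //; exact: commute_sym.
  by rewrite (step_lk w s x L1) (step_lk w s x L2) addrC.
Qed.

Lemma shift_path w s x u : is_word S u -> shift w s x (x * weval u) = ssum w s x u.
Proof.
move=> Su; rewrite /shift mulKg; apply: ssum_equiv.
by have [Sw Ew] := wordP (weval u); apply: (raag_presented GS).
Qed.

Lemma shift_add w s x y z : (shift w s x y + shift w s y z)%R = shift w s x z.
Proof.
have [u Su Eu] := raag_generated GS (x^-1 * y).
have [v Sv Ev] := raag_generated GS (y^-1 * z).
have Ey : y = x * weval u by rewrite Eu mulVKg.
have -> : z = y * weval v by rewrite Ev mulVKg.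
rewrite Ey (shift_path _ _ _ Su) (shift_path _ _ _ Sv) -ssum_cat -mulgA -weval_cat.
by rewrite shift_path //; apply/is_word_cat.
Qed.

Lemma shiftxx w s x : shift w s x x = 0%R.
Proof. by apply: (@addrI _ (shift w s x x)); rewrite shift_add addr0. Qed.

Lemma shiftN w s x y : shift w s y x = (- shift w s x y)%R.
Proof. by apply/eqP; rewrite -addr_eq0 shift_add shiftxx. Qed.

(** [f] records whether [g] reverses orientations. Only walls between [x] and [y] are constrained,
    since the commutation criterion controls no others. *)
Lemma shift_map w s g (f : bool) x y :
  (forall k, k.1 = s -> side S k x != side S k y ->
     (crosses w (mv g k) <-> crosses w k) /\
     (crosses w k -> eps w (mv g k) = eps w k (+) f)) ->
  shift w s (g * x) (g * y) = (if f then - shift w s x y else shift w s x y)%R.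
Proof.
have [u gu Eu] := geodesic_ex (x^-1 * y) => H.
have {}H k : k.1 = s -> wall S k \in walls S x u -> (crosses w (mv g k) <-> crosses w k) /\
     (crosses w k -> eps w (mv g k) = eps w k (+) f).
  move=> ks ku; apply: H => //; have := side_geodesic k x gu.
  by rewrite ku Eu mulVKg => ->; case: side.
have [Su _] := gu; rewrite -(mulVKg x y) -Eu mulgA !shift_path // {gu}.
elim: u x Su H {Eu} => [|c u IH] x; first by case: (f); rewrite /= ?oppr0.
move=> /is_word_cons[Sc Su] H /=; rewrite -mulgA IH // => [|k ks ku]; last first.
  by apply: H; rewrite //= inE ku orbT.
have -> : step w s (g * x) c = (if f then - step w s x c else step w s x c)%R.
  rewrite /step baseM; case: eqP => [cs|] /=; last by case: (f); rewrite ?oppr0.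
  have [] := H (c.1, base x c) cs (mem_head _ _); rewrite /mv /= => -[H1 H2] H3.
  case: asboolP => [/H1 wc|nc]; case: asboolP => wc' //; last by case: (f); rewrite ?oppr0.
    by rewrite H3 //; case: (c.2); case: eps; case: (f).
  by case: nc; apply: H2.
by case: (f); rewrite ?opprD.
Qed.

Lemma shift_commute w s g x y : commute g w -> shift w s (g * x) (g * y) = shift w s x y.
Proof.
move=> gw; apply: (@shift_map _ _ _ false) => k _ _; split; first exact: crosses_commute.
by move=> wk; rewrite eps_commute // addbF.
Qed.

Lemma shift_base w s g x y : commute g w -> shift w s x (g * x) = shift w s y (g * y).
Proof.
move=> gw; rewrite -(shift_add _ _ _ y) -(shift_add _ _ y (g * y) (g * x)).
by rewrite shift_commute // addrCA shift_add shiftxx addr0.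
Qed.

Lemma geodesic_edge x u1 c u2 : geodesic S (u1 ++ c :: u2) ->
  side S (c.1, base (x * weval u1) c) x = ~~ c.2 /\
  side S (c.1, base (x * weval u1) c) (x * weval (u1 ++ c :: u2)) = c.2.
Proof.
move=> gu; set k := (c.1, _); have [Su _] := gu.
have Sc : S c.1 by apply: Su; rewrite mem_cat mem_head orbT.
have kW : wall S k \in walls S x (u1 ++ c :: u2) by rewrite walls_cat mem_cat mem_head orbT.
have [E1 _] := side_base_letter (x * weval u1) Sc.
have E2 : side S k (x * weval u1) = side S k x.
  rewrite (side_geodesic k x (geodesic_prefix gu)).
  have := geodesic_uniq x gu; rewrite walls_cat cat_uniq /= => /and3P[_].
  by rewrite negb_or => /andP[/negbTE -> _] _; rewrite addbF.
by rewrite side_geodesic // kW -E2 E1 addbT negbK.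
Qed.

Lemma ssum_ge0 w s x u :
  (forall u1 c u2, u = u1 ++ c :: u2 -> (0 <= step w s (x * weval u1) c)%R) ->
  (0 <= ssum w s x u)%R.
Proof.
elim: u x => [//|c u IH] x H /=; apply: addr_ge0.
  by have := H [::] c u erefl; rewrite weval_nil mulg1.
by apply: IH => u1 d u2 E; have := H (c :: u1) d u2; rewrite E weval_cons mulgA; apply.
Qed.

Lemma step_ge0 w s x u1 c u2 : geodesic S (u1 ++ c :: u2) ->
  (forall k, k.1 = s -> crosses w k -> side S k x = eps w k ->
     side S k (x * weval (u1 ++ c :: u2)) = eps w k) ->
  (0 <= step w s (x * weval u1) c)%R.
Proof.
move=> gu H; rewrite /step; case: eqP => //= cs; case: asboolP => // wc.
have [E1 E2] := geodesic_edge x gu; case: eqP => // /nesym /neq_negb ce.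
by move: (H (c.1, base (x * weval u1) c) cs wc); rewrite E1 E2 ce => /(_ erefl); case: c.2.
Qed.

Lemma shift_ge0 w s x y : (forall k, k.1 = s -> crosses w k -> side S k x = eps w k ->
  side S k y = eps w k) -> (0 <= shift w s x y)%R.
Proof.
have [u gu Eu] := geodesic_ex (x^-1 * y); rewrite -(mulVKg x y) -Eu => H.
have [Su _] := gu; rewrite shift_path //; apply: ssum_ge0 => u1 c u2 E.
by apply: (@step_ge0 _ _ _ _ _ u2); rewrite -E.
Qed.

(** By [crosses_chain] no wall with this label between [x] and [y] counts negatively, so nothing
    compensates the contribution of [h]. *)
Lemma shift_gt0 w h x y : crosses w h -> side S h x = ~~ eps w h -> side S h y = eps w h ->
  (0 < shift w h.1 x y)%R.
Proof.
move=> wh hx hy; have [u gu Eu] := geodesic_ex (x^-1 * y).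
have Ey : x * weval u = y by rewrite Eu mulVKg.
have H k : k.1 = h.1 -> crosses w k -> side S k x = eps w k -> side S k y = eps w k.
  by move=> kh wk; apply: (crosses_chain wh wk _ hx hy).
have := side_geodesic h x gu; rewrite Ey hx hy.
case hu: (_ \in _); last by case: eps.
have [u1 [c [u2 [E EW]]]] := mem_walls hu => _.
have [hc Es] : h.1 = c.1 /\ side S h = side S (c.1, base (x * weval u1) c) by case: EW.
have [Su _] := gu; rewrite -Ey shift_path // E ssum_cat /=.
have gu' : geodesic S (u1 ++ c :: u2) by rewrite -E.
have [E1 E2] := geodesic_edge x gu'.
have -> : step w h.1 (x * weval u1) c = 1%R.
  rewrite /step hc eqxx /= -(crosses_sideE w Es) -(eps_side w Es).
  case: asboolP => // _; move: E2; rewrite -Es -E Ey hy => ->.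
  by rewrite eqxx.
apply: ltr_wpDl; first (apply: ssum_ge0 => v1 d v2 E').
  apply: (@step_ge0 _ _ _ _ _ (v2 ++ c :: u2)).
    by rewrite -cat_cons catA -E'.
  by rewrite -cat_cons catA -E' -E Ey.
apply: ltr_pwDl => //; apply: ssum_ge0 => v1 d v2 E'.
rewrite -!mulgA mulgA -weval_cons -mulgA -weval_cat.
apply: (@step_ge0 _ _ _ _ _ v2).
  by rewrite -catA /= -E'.
by rewrite -catA /= -E' -E Ey.
Qed.

Lemma shift_eq0 w h x y : shift w h.1 x y = 0%R -> crosses w h -> side S h x = side S h y.
Proof.
move=> E wh; case: (side S h x =P eps w h) => [xE|/neq_negb xE];
  case: (side S h y =P eps w h) => [yE|/neq_negb yE]; rewrite ?xE ?yE //.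
  by have := shift_gt0 wh yE xE; rewrite shiftN E oppr0.
by have := shift_gt0 wh xE yE; rewrite E.
Qed.

Lemma shift_ge0_eps w h x y : (0 <= shift w h.1 x y)%R -> crosses w h ->
  side S h x = eps w h -> side S h y = eps w h.
Proof.
move=> E wh xE; case: (side S h y =P eps w h) => // /neq_negb yE.
by have := shift_gt0 wh yE xE; rewrite shiftN oppr_gt0 ltNge E.
Qed.

Lemma commute_points w g x : (forall s, shift w s (g * (w * x)) (w * (g * x)) = 0%R) ->
  (forall h, ~ crosses w h -> side S h (g * (w * x)) = side S h (w * (g * x))) ->
  commute g w.
Proof.
move=> H1 H2; suff : g * (w * x) = w * (g * x) by rewrite !mulgA => /mulIg.
apply: side_inj => h; case: (pselect (crosses w h)) => wh; last exact: H2.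
exact: shift_eq0 wh.
Qed.

(* A reversal would make [g ^+ 2], hence [g] itself, fix some wall. *)
Lemma eps_preserved w g h : (forall k, crosses w (mv g k) <-> crosses w k) ->
  crosses w h -> eps w (mv g h) = eps w h.
Proof.
move=> gI wh; apply: contrapT => /neq_negb rev.
have revs k : k.1 = h.1 -> crosses w k -> eps w (mv g k) = eps w k (+) true.
  move=> kh wk; rewrite addbT; case: (eps w (mv g k) =P eps w k) => [kE|/neq_negb //].
  (* If [g] reverses [h] but not [k], far points of the axes occupy two quadrants and the images of
     far points under [g^-1] the two mixed ones. *)
  have : lk S h.1 k.1; last by rewrite kh => -[].
  have wgh : crosses w (mv g h) by apply/gI.
  have wgk : crosses w (mv g k) by apply/gI.
  have [[z1 [hz1 kz1]] [z2 [hz2 kz2]]] := crosses_ends 1 wh wk.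
  have [[z3 [hz3 kz3]] [z4 [hz4 kz4]]] := crosses_ends 1 wgh wgk.
  move: hz3 kz3 hz4 kz4; rewrite !side_mvE rev kE => hz3 kz3 hz4 kz4.
  apply: crossing_lk => e d.
  case: (e =P eps w h) => [->|/neq_negb ->]; case: (d =P eps w k) => [->|/neq_negb ->].
  - by exists z1.
  - by exists (g^-1 * z4) => //; rewrite hz4 negbK.
  - by exists (g^-1 * z3).
  - by exists z2.
(* The signed number from [g * x] to [g ^+ 2 * x] is the opposite of that from [x] to [g * x], so
   the total is zero and [h] does not separate [x] from [g ^+ 2 * x]. *)
have T2 : type0 (g ^+ 2) h.
  move=> x; apply/esym; apply: (@shift_eq0 w) => //.
  rewrite expg2 -mulgA -(shift_add _ _ x (g * x)).
  rewrite (@shift_map w h.1 g true x (g * x)) ?addrN // => k kh _.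
  by split; [exact: gI|exact: revs].
have T1 : type0 g h by apply: (@type0_root _ _ 1 T2).
have E : side S (mv g h) = side S h.
  by apply/funext => x; rewrite side_mvE -{2}(mulVKg g x) T1.
by move: rev; rewrite (eps_side w E); case: eps.
Qed.

Lemma lim_not_crosses w b h : Xset S w b -> ~ crosses w h -> lim w b h = side S h b.
Proof.
by move=> Xb nh; apply: (@lim_eq _ _ _ _ 0) => m _; exact: (side_expgz (Posz m) Xb nh).
Qed.

(* Far along the axis, [g] maps the walls still to be crossed into the walls
   crossed by the axes of [w]; then [g w x] and [w g x] are separated by such
   walls only, and the signed numbers of these walls vanish. *)
Lemma commute_criterion w g b : Xset S w b ->
  (forall h, crosses w h -> lim w b (mv g h) = lim w b h) ->
  (forall h, lim w b (mv g^-1 (mv w h)) = lim w b (mv g^-1 h)) ->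
  commute g w.
Proof.
move=> Xb H1 H2; have [n Hn] := lim_unif w b (g^-1 * b) b.
(* By the choice of [n], walls between [g^-1 * b] and [b] have their limit side at [x]; a wall still
   to be crossed therefore has both of these points on its repelling side. *)
pose x := w ^+ n * b.
have xnc h : ~ crosses w h -> side S h x = side S h b by apply: (side_expgz (Posz n) Xb).
have wxnc h : ~ crosses w h -> side S h (w * x) = side S h b.
  by rewrite /x mulgA -expgS; apply: (side_expgz (Posz n.+1) Xb).
have claim h : side S h x != lim w b h ->
  [/\ crosses w h, side S h x = ~~ eps w h, crosses w (mv g h) & eps w (mv g h) = eps w h].
  move=> hx; have wh : crosses w h.
    by apply: contrapT => nh; move: hx; rewrite xnc // lim_not_crosses // eqxx.
  have [T1 _ _] := crosses_eps wh.
  have hx' : side S h x = ~~ eps w h.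
    by apply: neq_negb => E; move: hx; rewrite E lim_crosses // eqxx.
  have hb : side S h b = ~~ eps w h.
    apply: neq_negb => E; have := mono_expg T1 n E.
    by rewrite -/x hx'; case: eps.
  have ghb : side S (mv g h) b = ~~ eps w h.
    rewrite side_mvE -hb; apply/eqP/negPn/negP => /(Hn n h (leqnn n)) E.
    by move: hx; rewrite E eqxx.
  have El : lim w b (mv g h) = eps w h by rewrite H1 // lim_crosses.
  have wgh : crosses w (mv g h).
    apply: contrapT => ngh; move: El; rewrite lim_not_crosses // ghb.
    by case: eps.
  by split=> //; rewrite -El lim_crosses.
have claim' h : side S h (w * x) != lim w b h -> side S h x != lim w b h.
  move=> hwx; have wh : crosses w h.
    by apply: contrapT => nh; move: hwx; rewrite wxnc // lim_not_crosses // eqxx.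
  apply: contra hwx; rewrite lim_crosses // => /eqP E.
  by have [T1 _ _] := crosses_eps wh; rewrite T1.
(* The number from [g * (w * x)] to [w * (g * x)] is a difference of two numbers counted from
   [g * x]; one equals that from [x] to [w * x] by [claim], the other by independence of the base
   point. *)
apply: (@commute_points w g x) => [s|h nh].
  rewrite -(shift_add _ _ _ (g * x)) shiftN.
  rewrite (@shift_map w s g false x (w * x)) => [|k _ kx].
    by rewrite (@shift_base w s w (g * x) x) // addNr.
  have wk : crosses w k.
    by apply: contrapT => nk; move: kx; rewrite xnc // wxnc // eqxx.
  have [|_ _ wgk E] := claim k; last by rewrite addbF.
  rewrite lim_crosses //; apply: contra kx => /eqP E.
  by have [T1 _ _] := crosses_eps wk; rewrite T1 E.
apply/eqP/negPn/negP => Hne.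
have nc k : side S k x != lim w b k -> mv g k <> h.
  by move=> /claim[_ _ wgk _] E; apply: nh; rewrite -E.
case E1 : (side S h (g * (w * x)) == lim w b (mv g^-1 h)); last first.
  apply: (@nc (mv g^-1 h)); last exact: mvVK.
  by apply: claim'; rewrite side_mvE invgK E1.
case E2 : (side S h (w * (g * x)) == lim w b (mv g^-1 h)); last first.
  have [] := claim (mv g^-1 (mv w^-1 h)).
    by rewrite !side_mvE !invgK -(H2 (mv w^-1 h)) mvVK E2.
  move=> _ _; rewrite mvVK => wh _; apply: nh.
  by apply/(@crosses_commute w w^-1 h) => //; apply: commute_sym; apply: commuteV.
by move: Hne; rewrite (eqP E1) (eqP E2) eqxx.
Qed.

End Shifts.

(** * Stabilizers *)

Section Stabilizers.
Implicit Types (s t g w x y z a b : G) (h k : G * G) (e d : bool) (n m : nat).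
Implicit Types (u v : seq (G * bool)) (c : G * bool).

Lemma act_setP g (X : set G) : act_set g X = X <-> forall x, X (g * x) <-> X x.
Proof.
split=> [E x|H].
  split=> [|Xx]; last by rewrite -E; exists x.
  by rewrite -{1}E => -[y Xy /mulgI <-].
apply/seteqP; split=> [_ [x Xx <-]|x Xx]; first exact/H.
by exists (g^-1 * x); rewrite ?mulVKg //; apply/H; rewrite mulVKg.
Qed.

Lemma side_const_dec h :
  (exists x y, side S h x != side S h y) \/ forall x y, side S h x = side S h y.
Proof.
case: (pselect (exists x y, side S h x != side S h y)) => H; [by left|right] => x y.
by apply/eqP/negPn/negP => hxy; apply: H; exists x, y.
Qed.

Lemma type0_lk w h k x y : crosses w h -> type0 w k -> side S k x != side S k y ->
  lk S h.1 k.1.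
Proof.
move=> /crosses_eps[_ Tp Tn] Tk kxy; apply: crossing_lk => e d.
have [z kz] : exists z, side S k z = d.
  case: (side S k x =P d) => [|/neq_negb xd]; first by exists x.
  by exists y; move: kxy; rewrite xd; case: (side S k y); case: (d).
case: (e =P eps w h) => [->|/neq_negb ->].
  by have [n Hn] := Tp z; exists (w ^+ n * z); [|rewrite type0X].
have [n Hn] := Tn z; exists (w ^- n * z); first exact: Hn.
by rewrite -expVgn type0X //; apply: type0V.
Qed.

(** A crossed wall separates points of X_w, and so does its image under [g]. Walls of [typeII] do
    not, and a wall fixed by [w] that separates two points cannot have the label of a crossed
    wall. *)
Lemma stab_Xset_crosses w g h : (forall x, Xset S w (g * x) <-> Xset S w x) ->
  crosses w h -> crosses w (mv g h).
Proof.
move=> gX wh; have [e T] := wh.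
have sepX : exists x y, [/\ Xset S w x, Xset S w y & side S h x != side S h y].
  have [_ Tp Tn] := T; pose b := phi S w 1.
  have [n Hn] := Tp b; have [m Hm] := Tn b; exists (w ^+ n * b), (w ^- m * b).
  split; last by rewrite Hn Hm; case: (e).
    apply/(Xset_commute b (expgz_commute w (Posz n))); exact: Xset_phi.
  rewrite -expgzN; apply/(Xset_commute b (expgz_commute w _)); exact: Xset_phi.
have [x [y [Xx Xy hxy]]] := sepX.
have ghxy : side S (mv g h) (g * x) != side S (mv g h) (g * y) by rewrite !side_mv.
have [T'|[e' T']|[e' T']] := trichotomy w (mv g h).
- by have := type0_lk wh T' ghxy => -[].
- by exists e'.
- move/gX/XsetP: Xx => /(_ _ _ T') Ex; move/gX/XsetP: Xy => /(_ _ _ T') Ey.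
  by move: ghxy; rewrite Ex Ey eqxx.
Qed.

Lemma mem_mvV (P : G * G -> Prop) g : (forall h, P h -> P (mv g h)) ->
  (forall h, P h -> P (mv g^-1 h)) -> forall h, P (mv g h) <-> P h.
Proof. by move=> H1 H2 h; split; [move=> /H2; rewrite mvK|exact: H1]. Qed.

Lemma stab_Xset w : Stab act_set (Xset S w) = centralizer w.
Proof.
apply/seteqP; split=> g; last first.
  by move=> gw; apply/act_setP => x; exact: Xset_commute.
move=> /act_setP gX.
have gX' x : Xset S w (g^-1 * x) <-> Xset S w x by rewrite -(gX (_ * x)) mulVKg.
have gI := mem_mvV (fun h => @stab_Xset_crosses w g h gX)
  (fun h => @stab_Xset_crosses w g^-1 h gX').
have gI' k : crosses w (mv g^-1 k) <-> crosses w k by rewrite -(gI (mv _ k)) mvVK.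
have Xb := Xset_phi w 1; apply: (commute_criterion Xb) => h.
  by move=> wh; rewrite !lim_crosses ?eps_preserved //; apply/gI.
case: (pselect (crosses w h)) => [wh|nh].
  have wwh : crosses w (mv w h) by apply/crosses_commute.
  rewrite !lim_crosses; [|exact/gI'|exact/gI'].
  by rewrite (eps_preserved gI' wwh) (eps_preserved gI' wh) eps_commute.
have nwh : ~ crosses w (mv w h) by move=> /crosses_commute; apply: contra_not nh; apply.
have [T|[e T]|[e T]] := trichotomy w h.
- apply: lim_side; apply/funext => x; rewrite !side_mvE.
  exact: type0V.
- by case: nh; exists e.
- rewrite !(lim_not_crosses Xb); [|by move=> /gI'|by move=> /gI'].
  rewrite !side_mvE invgK; have Xgb : Xset S w (g * phi S w 1) by apply/gX.
  move/XsetP: (Xgb) => /(_ _ _ T) ->.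
  have /XsetP/(_ _ _ T) -> // : Xset S w (w^-1 * (g * phi S w 1)).
  by apply/Xset_commute => //; apply: commute_sym; apply: commuteV.
Qed.

(** X_w and X_(w,b) are the fixed sets of phi_w and Psi_(w,b), so stabilizers of these maps
    stabilize the sets. *)
Lemma stab_fixpoints g (f : G -> G) : act_map g f = f -> forall x, f (g * x) = g * x <-> f x = x.
Proof.
move=> E x; rewrite -{1}E /act_map mulKg; split=> [/mulgI //|-> //].
Qed.

Lemma stab_phi w : Stab act_map (phi S w) = centralizer w.
Proof.
apply/seteqP; split=> g.
  move=> /stab_fixpoints E; rewrite -stab_Xset; apply/act_setP => x.
  have XE y : Xset S w y <-> phi S w y = y.
    by split=> [|<-]; [exact: Xset_phi_id|exact: Xset_phi].
  by rewrite !XE.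
move=> gw; apply/funext => x; rewrite /act_map /phi -medianM.
have gw' : commute g w^-1 by apply: commuteV.
have H (v : G) : commute g v -> g * (v * (g^-1 * x)) = v * x.
  by move=> gv; rewrite mulgA gv -mulgA mulVKg.
by rewrite !H // mulVKg.
Qed.

Lemma lim_commute w g x h : commute g w -> lim w (g * x) (mv g h) = lim w x h.
Proof. by move=> gw; rewrite -lim_conj commute_conjg. Qed.

Lemma stab_bullet w : Stab act_op (bullet S w) = centralizer w.
Proof.
apply/seteqP; split=> g; last first.
  move=> gw; apply/funext => x; apply/funext => y; apply: side_inj => h.
  rewrite /act_op -{1}(mvVK g h) side_mv !side_bullet !side_mvE !invgK !mulVKg.
  have gw' : commute g^-1 w by exact: commuteVl.
  by rewrite (lim_commute x h gw').
move=> E.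
(* If [h] separates [x] from some [p], the limit casts the deciding vote in the bullet of [x] and
   [p]; if [h] separates nothing, all sides involved are constant. *)
have star x h : lim w (g^-1 * x) (mv g^-1 h) = lim w x h.
  have [[y [z hyz]]|H] := side_const_dec h.
    have [p hp] : exists p, side S h p = ~~ side S h x.
      case: (side S h y =P side S h x) => [yx|/neq_negb]; last by exists y.
      by exists z; move: hyz; rewrite yx; case: (side S h x); case: (side S h z).
    have := congr1 (fun f => side S h (f x p)) E.
    rewrite /act_op -{1}(mvVK g h) side_mv !side_bullet !side_mvE !invgK !mulVKg hp /maj.
    by case: eqP => //; case: side.
  have T k : (forall x y, side S k x = side S k y) -> type0 w k by move=> Hk y.
  have T' : type0 w (mv g^-1 h) by apply: T => y z; rewrite !side_mvE.
  by rewrite (lim_type0 x (T _ H)) (lim_type0 _ T') side_mvE.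
have star' x h : lim w (g * x) (mv g h) = lim w x h.
  by have := star (g * x) (mv g h); rewrite mulKg mvK.
have lim0 k : (forall x, lim w x k = side S k x) <-> type0 w k.
  split=> [H x|T x]; last exact: lim_type0.
  by rewrite -!H limM.
have Xb := Xset_phi w 1; apply: (commute_criterion Xb) => h.
  (* Being fixed by [w] is visible in the limits by [lim0], so [g] carries no crossed wall to a
     fixed one; for the remaining types limits forget the base point. *)
  move=> wh; have nT : ~ type0 w (mv g h).
    move=> /lim0 T; have /lim0 T0 : forall x, lim w x h = side S h x.
      by move=> x; rewrite -star' T side_mv.
    have [e [_ T2 T3]] := wh; have [n Hn] := T2 1; have [m Hm] := T3 1.
    move: Hm; rewrite -expVgn type0X; last exact: type0V.
    by move: Hn; rewrite type0X // => ->; case: (e).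
  rewrite -[RHS]star'.
  have [//|[e T]|[e T]] := trichotomy w (mv g h); first by rewrite !(lim_typeI _ T).
  by rewrite !(lim_typeII _ T).
have star2 k : lim w (phi S w 1) (mv g^-1 k) = lim w (g * phi S w 1) k.
  by have := star (g * phi S w 1) k; rewrite mulKg.
by rewrite !star2 lim_mv.
Qed.

(** The common value of the last three stabilizers; conjugation by [b] turns it into the group H_v
    for [v = w ^ b], see [HgroupP]. *)
Definition Hstab w b : set G := [set g | commute g w /\ in_axis w b (g * b)].

Lemma in_axis_expgz w b (n : int) : Xset S w b -> in_axis w b (expgz w n * b).
Proof. by move=> Xb h; apply: side_expgz. Qed.

Lemma stab_axis w b : Xset S w b -> Stab act_set (Xaxis S w b) = Hstab w b.
Proof.
move=> Xb; apply/seteqP; split=> g; last first.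
  move=> [gw Cgb]; apply/act_setP => x; rewrite !XaxisP //; split=> Cx h nh.
    rewrite -(side_mv g h x) -(side_mv g h b).
    by rewrite Cx ?Cgb // => /crosses_commute; apply: contra_not nh; apply.
  rewrite -(mvVK g h) side_mv Cx; last first.
    by apply: contra_not nh => H; rewrite -(mvVK g h); apply/crosses_commute.
  by rewrite -(side_mv g) mvVK Cgb.
move=> /act_setP; set gC := (X in X -> _) => gC0.
have gA x : in_axis w b (g * x) <-> in_axis w b x by rewrite -!XaxisP.
have gA' x : in_axis w b (g^-1 * x) <-> in_axis w b x by rewrite -(gA (_ * x)) mulVKg.
have cr g' h : (forall x, in_axis w b (g' * x) <-> in_axis w b x) ->
    crosses w h -> crosses w (mv g' h).
  move=> gA2 [e [_ T2 T3]]; apply: contrapT => nh.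
  have [n Hn] := T2 b; have [m Hm] := T3 b.
  have := (proj2 (gA2 _) (in_axis_expgz (Posz n) Xb)) _ nh.
  have := (proj2 (gA2 _) (in_axis_expgz (- Posz m)%R Xb)) _ nh.
  by rewrite expgzN /= !side_mv Hn Hm => <-; case: (e).
have gI := mem_mvV (fun h => @cr g h gA) (fun h => @cr g^-1 h gA').
have gI' k : crosses w (mv g^-1 k) <-> crosses w k by rewrite -(gI (mv _ k)) mvVK.
have Cgb : in_axis w b (g * b) by apply/gA.
split=> //.
have limg h : lim w b (mv g^-1 h) = lim w b h.
  case: (pselect (crosses w h)) => wh.
    by rewrite !lim_crosses ?eps_preserved //; apply/gI'.
  by rewrite !lim_not_crosses ?side_mvE ?invgK ?Cgb //; move/gI'.
apply: (commute_criterion Xb) => h; last by rewrite !limg lim_mv.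
by move=> wh; rewrite !lim_crosses ?eps_preserved //; apply/gI.
Qed.

Lemma stab_Psi w b : Xset S w b -> Stab act_map (Psi S w b) = Hstab w b.
Proof.
move=> Xb; apply/seteqP; split=> g.
  move=> /stab_fixpoints E; rewrite -stab_axis //; apply/act_setP => x.
  have AE y : Xaxis S w b y <-> Psi S w b y = y.
    rewrite XaxisP //; have [P1 P2] := Psi_spec y Xb; split=> [Cy|<- //].
    apply: side_inj => h; case: (pselect (crosses w h)) => wh; first exact: P2.
    by rewrite P1 // Cy.
  by rewrite !AE.
move=> [gw Cgb]; apply/funext => x; apply: side_inj => h; rewrite /act_map.
have [P1 P2] := Psi_spec x Xb; have [Q1 Q2] := Psi_spec (g^-1 * x) Xb.
rewrite -{1}(mvVK g h) side_mv.
have gw' : commute g^-1 w by exact: commuteVl.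
case: (pselect (crosses w h)) => wh.
  by rewrite P2 // Q2 ?side_mvE ?invgK ?mulVKg //; apply/crosses_commute.
rewrite P1 // Q1 ?side_mvE ?invgK ?Cgb //.
by move=> /(crosses_commute _ gw').
Qed.

Lemma lim_phi w a h : lim w (phi S w a) h = lim w a h.
Proof.
have [T|[e T]|[e T]] := trichotomy w h.
- by rewrite !lim_type0 // phi_type0.
- by rewrite !(lim_typeI _ T).
- by rewrite !(lim_typeII _ T).
Qed.

(** On a wall separating two points the limit of [a] casts the deciding vote, so [g] preserves this
    limit. On walls that are not crossed the limit is the side of [b], which places [g * b] in the
    axis. *)
Lemma stab_vee w a : Stab act_op (vee S w a) = Hstab w (phi S w a).
Proof.
have Xb := Xset_phi w a; set b := phi S w a in Xb *.
apply/seteqP; split=> g; last first.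
  move=> [gw Cgb]; apply/funext => x; apply/funext => y; apply: side_inj => h.
  rewrite /act_op -{1}(mvVK g h) side_mv !side_vee !side_mvE !invgK !mulVKg.
  rewrite -(lim_phi w a h) -(lim_phi w a (mv g^-1 h)) -/b.
  congr (maj _ _ _).
  have gw' : commute g^-1 w by exact: commuteVl.
  case: (pselect (crosses w h)) => wh.
    by rewrite !lim_crosses ?eps_commute //; apply/crosses_commute.
  rewrite !lim_not_crosses ?side_mvE ?invgK ?Cgb //.
  by move=> /(crosses_commute _ gw').
move=> E.
have limg h : lim w b (mv g^-1 h) = lim w b h.
  rewrite !lim_phi.
  have [[y [z hyz]]|H] := side_const_dec h.
    have := congr1 (fun f => side S h (f y z)) E.
    rewrite /act_op -{1}(mvVK g h) side_mv !side_vee !side_mvE !invgK !mulVKg /maj.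
    by rewrite (negbTE hyz).
  by apply: lim_side; apply/funext => x; rewrite side_mvE; exact: H.
have limg' h : lim w b (mv g h) = lim w b h by rewrite -limg mvK.
have gw : commute g w.
  by apply: (commute_criterion Xb) => h; rewrite ?limg' // !limg lim_mv.
have gw' : commute g^-1 w by exact: commuteVl.
split=> // h nh; rewrite -(lim_not_crosses Xb nh) -limg lim_not_crosses ?side_mvE ?invgK //.
by move=> /(crosses_commute _ gw').
Qed.

End Stabilizers.

(** * The positive cone of the stabilizer *)

Section PositiveCone.
Implicit Types (s t g w x y z a b p q : G) (h k : G * G) (e d : bool) (n m : nat).
Implicit Types (u v : seq (G * bool)) (c : G * bool) (T U P : set G).

(** The retraction onto a parabolic subgroup, killing the generators outside [P]. Each relation goes
    to a relation or disappears, so the chosen word does not matter. *)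
Definition retract P x : G := weval [seq c <- word S x | `[< P c.1 >]].

Lemma retract_weval P u : is_word S u -> retract P (weval u) = weval [seq c <- u | `[< P c.1 >]].
Proof.
move=> Su; have [Sw Ew] := wordP (weval u); have := raag_presented GS Sw Su Ew.
rewrite /retract; move: (word S _) => v E; elim: E => {u v Su Sw Ew}
  [//|u v _ -> //|u v r _ -> _ -> //|a b u v E IH|t e St|t t' St St' tt' ct].
- by rewrite !filter_cat !weval_cat IH.
- rewrite /=; case: asboolP => //= _; rewrite weval_cons weval1 weval_nil /letter /=.
  by case: e; rewrite /= (mulgV, mulVg).
- rewrite /=; case: asboolP => _; case: asboolP => _ //.
  by rewrite !weval_cons !weval_nil !mulg1 /letter /=.
Qed.

Lemma retractM P x y : retract P (x * y) = retract P x * retract P y.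
Proof.
have [u Su <-] := raag_generated GS x; have [v Sv <-] := raag_generated GS y.
by rewrite -weval_cat !retract_weval ?filter_cat ?weval_cat //; apply/is_word_cat.
Qed.

Lemma retract_gen P U x : gen S U x -> gen S (U `&` P) (retract P x).
Proof.
move=> [u [Su Uu <-]]; rewrite retract_weval //; eexists; split; [|move=> c|by []].
  exact: is_word_filter.
by rewrite mem_filter => /andP[/asboolP Pc /Uu].
Qed.

Lemma retract_id P U x : gen S U x -> U `<=` P -> retract P x = x.
Proof.
move=> [u [Su Uu <-]] UP; rewrite retract_weval //; congr weval.
by apply/all_filterP/allP => c /Uu /UP /asboolP.
Qed.

Lemma retract_1 P U x : gen S U x -> (forall s, U s -> ~ P s) -> retract P x = 1.
Proof.
move=> [u [Su Uu <-]] UP; rewrite retract_weval // (_ : filter _ u = [::]) ?weval_nil //.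
apply/eqP; rewrite -[_ == _]negbK -has_filter; apply/hasPn => c /Uu /UP.
by move=> H; apply/negP => /asboolP.
Qed.

Lemma retract_split P U x : gen S U x ->
  (forall s t, U s -> U t -> P s -> ~ P t -> commute s t) ->
  x = retract P x * retract (~` P) x.
Proof.
move=> [u [Su Uu <-]] UP; rewrite !retract_weval //.
elim: u Su Uu => [|c u IH] Su Uu; first by rewrite /= weval_nil mulg1.
have /is_word_cons[Sc Su'] := Su.
have {}IH : weval u = weval [seq c <- u | `[< P c.1 >]] * weval [seq c <- u | `[< (~` P) c.1 >]].
  by apply: IH => // c' c'u; apply: Uu; rewrite inE c'u orbT.
rewrite weval_cons {1}IH /=; case: asboolP => Pc; case: asboolP => nPc.
- by case: nPc.
- by rewrite weval_cons mulgA.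
- rewrite weval_cons !mulgA; congr (_ * _).
  apply: commute_weval => d; rewrite mem_filter => /andP[/asboolP Pd du].
  apply: commute_letter; apply: commute_sym; apply: UP => //;
    apply: Uu; rewrite inE ?eqxx ?du ?orbT //.
- by case: nPc.
Qed.

Lemma gen_side U x y h : gen S U (x^-1 * y) -> ~ U h.1 -> side S h x = side S h y.
Proof.
move=> [u [Su Uu E]] nU; rewrite -(mulVKg x y) -E side_path // cross_notin ?addbF //.
by move=> c /Uu Uc ch; apply: nU; rewrite -ch.
Qed.

Lemma side_gen U x y : (forall h, side S h x != side S h y -> U h.1) -> gen S U (x^-1 * y).
Proof.
have [u gu Eu] := geodesic_ex (x^-1 * y) => H; rewrite -Eu; exists u; split=> //.
  by case: gu.
move=> c cu; have [v1 [v2 Ev]] : exists v1 v2, u = v1 ++ c :: v2.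
  by case/splitPr: cu => v1 v2; exists v1, v2.
have := H (c.1, base (x * weval v1) c); apply; rewrite -[y](mulVKg x) -Eu.
rewrite Ev in gu *; have [-> ->] := geodesic_edge x gu.
by case: c.2.
Qed.

Lemma shift_gen U w s x y : gen S U (x^-1 * y) -> ~ U s -> shift w s x y = 0%R.
Proof.
move=> [u [Su Uu E]] nU; rewrite -(mulVKg x y) -E shift_path //.
elim: u x Su Uu {E} => [//|c u IH] x /is_word_cons[Sc Su] Uu /=.
rewrite IH // => [|d du]; last by apply: Uu; rewrite inE du orbT.
rewrite addr0 /step; case: eqP => //= cs; case: nU; rewrite -cs.
by apply: Uu; rewrite mem_head.
Qed.

Definition labels w : set G := [set s | exists2 h, crosses w h & h.1 = s].

Lemma in_axis_gen w b x : in_axis w b x -> gen S (labels w) (b^-1 * x).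
Proof.
move=> Cx; apply: side_gen => h hbx; exists h => //; apply: contrapT => nh.
by move: hbx; rewrite Cx // eqxx.
Qed.

Lemma in_axis_M w b g x :
  commute g w -> in_axis w b (g * b) -> in_axis w b x -> in_axis w b (g * x).
Proof.
move=> gw Cg Cx h nh.
have nh' : ~ crosses w (mv g^-1 h).
  by apply: contra_not nh => H; rewrite -(mvVK g h); apply/crosses_commute.
by rewrite -(mvVK g h) side_mv (Cx _ nh') -(side_mv g) mvVK Cg.
Qed.

Section Hstab_theory.
Context (w b : G) (Xb : Xset S w b).

Definition sg s g : int := shift w s b (g * b).

Lemma Hstab1 : Hstab w b 1.
Proof. by split; [exact/commute_sym/commute1|rewrite mul1g]. Qed.

Lemma HstabM g g' : Hstab w b g -> Hstab w b g' -> Hstab w b (g * g').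
Proof.
move=> [gw Cg] [gw' Cg']; split.
  by apply: commute_sym; apply: commuteM; apply: commute_sym.
by rewrite -mulgA; apply: in_axis_M.
Qed.

Lemma HstabV g : Hstab w b g -> Hstab w b g^-1.
Proof.
move=> [gw Cg]; split; first exact: commuteVl.
move=> h nh; rewrite -(side_mv g h (g^-1 * b)) mulVKg -Cg ?side_mv //.
by apply: contra_not nh => /(crosses_commute _ gw).
Qed.

Lemma Hstab_w : Hstab w b w.
Proof. by split=> //; apply: (in_axis_expgz (Posz 1) Xb). Qed.

Lemma sgM s g g' : commute g w -> sg s (g * g') = (sg s g + sg s g')%R.
Proof. by move=> gw; rewrite /sg -(shift_add _ _ _ (g * b)) -mulgA shift_commute. Qed.

Lemma sg1 s : sg s 1 = 0%R.
Proof. by rewrite /sg mul1g shiftxx. Qed.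

Lemma sgV s g : commute g w -> sg s g^-1 = (- sg s g)%R.
Proof.
by move=> gw; apply/eqP; rewrite -addr_eq0 -sgM ?mulVg ?sg1 //; exact: commuteVl.
Qed.

Lemma sgX s g n : commute g w -> sg s (g ^+ n) = (sg s g *+ n)%R.
Proof. by move=> gw; elim: n => [|n IH]; rewrite ?sg1 // expgS sgM // IH mulrS. Qed.

Lemma sg_expgz s g (n : int) : commute g w -> sg s (expgz g n) = (sg s g * n)%R.
Proof.
move=> gw; case: n => n /=; first by rewrite sgX // -mulr_natr natz.
rewrite sgV ?sgX //; last by apply: commute_sym; apply: commuteX.
by rewrite NegzE mulrN -mulr_natr natz.
Qed.

Lemma sg_inj g : Hstab w b g -> (forall s, sg s g = 0%R) -> g = 1.
Proof.
move=> [_ Cg] H; suff E : g * b = b by apply: (@mulIg _ b); rewrite mul1g.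
apply: side_inj => h; case: (pselect (crosses w h)) => wh; last exact: Cg.
by apply/esym; apply: (shift_eq0 (H h.1) wh).
Qed.

Lemma Hstab_inj g g' : Hstab w b g -> Hstab w b g' -> (forall s, sg s g = sg s g') -> g = g'.
Proof.
move=> Hg Hg' H; apply: (@mulIg _ g'^-1); rewrite mulgV; apply: sg_inj.
  exact/HstabM/HstabV.
have [gw _] := Hg; have [gw' _] := Hg'.
by move=> s; rewrite (sgM s _ gw) (sgV s gw') H addrN.
Qed.

Lemma Hstab_commute g g' : Hstab w b g -> Hstab w b g' -> commute g g'.
Proof.
move=> Hg Hg'; apply: Hstab_inj; try exact: HstabM.
have [gw _] := Hg; have [gw' _] := Hg'.
by move=> s; rewrite (sgM s g' gw) (sgM s g gw') addrC.
Qed.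

Lemma sg_labels s g : Hstab w b g -> ~ labels w s -> sg s g = 0%R.
Proof. by move=> [_ /in_axis_gen H]; apply: shift_gen. Qed.

(** Independence of the base point allows computing at the point of the orbit of [b] whose next step
    crosses the wall. *)
Lemma sg_w_gt0 s : labels w s -> (0 < sg s w)%R.
Proof.
move=> [h wh <-]; have T := crosses_eps wh; have [T1 T2 T3] := T.
have [y yE] := T3 b; have [n Hn] := T2 (w ^- y * b).
elim: n (w ^- y * b) yE Hn => [|n IH] x xE Hn; first by move: Hn; rewrite mul1g xE; case: eps.
case: (side S h (w * x) =P eps w h) => [wx|/neq_negb wx].
  by rewrite /sg (@shift_base _ _ w _ x) //; apply: shift_gt0.
by apply: (IH _ wx); rewrite mulgA -expgSr.
Qed.

Lemma far_plus h : crosses w h ->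
  exists n : int, forall x, (n <= shift w h.1 b x)%R -> side S h x = eps w h.
Proof.
move=> wh; have [[y [hy _]] _] := crosses_ends b wh wh; exists (shift w h.1 b y) => x H.
apply: (@shift_ge0_eps _ _ y) => //.
by move: H; rewrite -(shift_add _ _ b y x) lerDl.
Qed.

Lemma far_minus h : crosses w h ->
  exists n : int, forall x, (shift w h.1 b x <= n)%R -> side S h x = ~~ eps w h.
Proof.
move=> wh; have [_ [y [hy _]]] := crosses_ends b wh wh; exists (shift w h.1 b y) => x H.
apply: neq_negb => hx; have : side S h y = eps w h.
  by apply: (@shift_ge0_eps _ _ x) => //; move: H; rewrite -(shift_add _ _ b x y) lerDl.
by rewrite hy; case: eps.
Qed.

(** Products of powers of [g] and [w] reach the mixed quadrants: [w] moves both coordinates the same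
    way, and [g] outweighs it at [s] without opposing it at [t]. *)
Lemma sg_sign_lk g s t : commute g w -> labels w s -> labels w t ->
  (0 < sg s g)%R -> (sg t g <= 0)%R -> lk S s t.
Proof.
move=> gw Ls Lt gs gt; have ws := sg_w_gt0 Ls; have wt := sg_w_gt0 Lt.
move: Ls Lt gs gt ws wt => [h wh <-] [k wk <-] gs gt ws wt.
have [[z1 [hz1 kz1]] [z2 [hz2 kz2]]] := crosses_ends b wh wk.
have [hp Hp] := far_plus wh; have [hm Hm] := far_minus wh.
have [kp Kp] := far_plus wk; have [km Km] := far_minus wk.
have sgE r (n m : int) : shift w r b (expgz g n * expgz w m * b) = (sg r g * n + sg r w * m)%R.
  rewrite -/(sg r _) sgM ?sg_expgz //.
  case: n => n /=; first by apply: commute_sym; apply: commuteX.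
  by apply: commuteVl; apply: commute_sym; apply: commuteX.
apply: crossing_lk => e d.
case: (e =P eps w h) => [->|/neq_negb ->]; case: (d =P eps w k) => [->|/neq_negb ->].
- by exists z1.
(* [m] alone is large enough for [k], where [g] does not push upwards; [n] then makes up for
   [w ^- m] at [h]. *)
- pose m := `|km|%N; pose n := (`|hp| + `|sg h.1 w| * m)%N.
  exists (expgz g n * expgz w (- (m : int))%R * b); [apply: Hp|apply: Km]; rewrite sgE /n /m; nia.
- pose m := `|kp|%N; pose n := (`|hm| + `|sg h.1 w| * m)%N.
  exists (expgz g (- (n : int))%R * expgz w m * b); [apply: Hm|apply: Kp]; rewrite sgE /n /m; nia.
- by exists z2.
Qed.

(** Seen from [b], both [g] and [w] split over [P] and its complement. The [P]-part of [g] commutes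
    with that of [w] because retraction is a homomorphism, and with the other part letter by
    letter. *)
Lemma Hstab_split g P : Hstab w b g ->
  (forall s t, labels w s -> labels w t -> P s -> ~ P t -> commute s t) ->
  exists k : G, [/\ Hstab w b k,
    forall s, P s -> sg s k = sg s g & forall s, ~ P s -> sg s k = 0%R].
Proof.
move=> [gw Cg] HP; have Rg := in_axis_gen Cg; have [_ /in_axis_gen Rw] := Hstab_w.
set r := b^-1 * (g * b) in Rg; set v := b^-1 * (w * b) in Rw.
have rv : commute r v.
  by rewrite /r /v -!conjgE /commute -!conjMg gw.
have Er := retract_split Rg HP; have Ev := retract_split Rw HP.
have RP := retract_gen P Rg; have RnP := retract_gen (~` P) Rg.
have kb : b * retract P r * b^-1 * b = b * retract P r by rewrite mulgVK.
have RP' : gen S (labels w `&` P) (b^-1 * (b * retract P r)) by rewrite mulKg.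
have RnP' : gen S (labels w `&` ~` P) ((b * retract P r)^-1 * (g * b)).
  by rewrite invgM -mulgA -/r {2}Er mulKg.
exists (b * retract P r * b^-1); split.
- split; last first.
    rewrite kb => h nh; case: (pselect (P h.1)) => Ph.
      by rewrite (gen_side RnP') ?Cg // => -[].
    by rewrite (gen_side RP') // => -[].
  have C : commute (retract P r) v.
    rewrite Ev; apply: commuteM; first by rewrite /commute -!retractM rv.
    apply: (commute_gen _ RP (retract_gen (~` P) Rw)) => s t _ _ [Ls Ps] [Lt nPt].
    exact: HP.
  have -> : w = v ^ b^-1 by rewrite /v -conjgE conjgK.
  have -> : b * retract P r * b^-1 = retract P r ^ b^-1 by rewrite conjgE invgK mulgA.
  by rewrite /commute -!conjMg C.
- move=> s Ps; rewrite /sg kb -[RHS](shift_add _ _ _ (b * retract P r)).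
  by rewrite (shift_gen _ RnP') ?addr0 // => -[].
- by move=> s nPs; rewrite /sg kb (shift_gen _ RP') // => -[].
Qed.

Definition Hpos : set G := [set g | Hstab w b g /\ forall s, (0 <= sg s g)%R].

(** The positive part: by [sg_sign_lk] the labels where [g] is positive commute with the others, so
    [Hstab_split] applies. It makes [g] a quotient of two positive elements. *)
Lemma Hpos_part g : Hstab w b g ->
  exists k : G, [/\ Hpos k, Hpos (g^-1 * k) & forall s, sg s k = Num.max (sg s g) 0%R].
Proof.
move=> Hg; have [gw _] := Hg; have [|k [Hk k1 k2]] := @Hstab_split g [set s | (0 < sg s g)%R] Hg.
  move=> s t Ls Lt /= s0 /negP; rewrite -leNgt => t0.
  by case: (sg_sign_lk gw Ls Lt s0 t0).
have kE s : sg s k = Num.max (sg s g) 0%R.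
  case: (ltP 0%R (sg s g)) => s0; first by rewrite k1 // max_l // ltW.
  by rewrite k2 ?max_r //= => /(le_lt_trans s0); rewrite ltxx.
exists k; split=> //; split=> //.
- by move=> s; rewrite kE le_max lexx orbT.
- exact/HstabM/Hk/HstabV.
- by move=> s; rewrite sgM ?sgV ?kE //; [lia|exact: commuteVl].
Qed.

(** As in a lattice-ordered group: the minimum is [g] without the positive part of [g * g'^-1]. *)
Lemma Hpos_meet g g' : Hpos g -> Hpos g' -> exists m : G,
  [/\ Hpos m, Hpos (m^-1 * g), Hpos (m^-1 * g') & forall s, sg s m = Num.min (sg s g) (sg s g')].
Proof.
move=> [Hg g0] [Hg' g0']; have [gw _] := Hg; have [gw' _] := Hg'.
have [k [[Hk k0] _ kE]] := Hpos_part (HstabM Hg (HstabV Hg')).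
have [kw _] := Hk.
have mE s : sg s (k^-1 * g) = Num.min (sg s g) (sg s g').
  rewrite sgM ?sgV ?kE ?sgM ?sgV //; last exact: commuteVl.
  by lia.
have Hm : Hstab w b (k^-1 * g) by apply: HstabM => //; exact: HstabV.
have [mw _] := Hm; have mw' := commuteVl mw.
exists (k^-1 * g); split=> //; split=> //.
- by move=> s; rewrite mE le_min g0 g0'.
- exact/HstabM/Hg/HstabV.
- by move=> s; rewrite sgM // sgV // mE; move: (g0' s); lia.
- exact/HstabM/Hg'/HstabV.
- by move=> s; rewrite sgM // sgV // mE; move: (g0' s); lia.
Qed.

Definition atom p : Prop := [/\ Hpos p, p <> 1 &
  forall g g', Hpos g -> Hpos g' -> p = g * g' -> g = 1 \/ g' = 1].

Lemma atom_disjoint p q s : atom p -> atom q -> p <> q -> sg s p = 0%R \/ sg s q = 0%R.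
Proof.
move=> [Hp p1 pA] [Hq q1 qA] pq; have [m [Hm Hmp Hmq mE]] := Hpos_meet Hp Hq.
have [m1|mp] := pA _ _ Hm Hmp (esym (mulVKg m p)).
  by have [_ p0] := Hp; have [_ q0] := Hq; move: (mE s) (p0 s) (q0 s); rewrite m1 sg1; lia.
have [m1|mq] := qA _ _ Hm Hmq (esym (mulVKg m q)).
  by case: p1; move: mp; rewrite m1 invg1 mul1g.
by case: pq; rewrite -(mulVKg m p) mp -(mulVKg m q) mq.
Qed.

Lemma wlength_gt0 x : x <> 1 -> (0 < wlength S x)%N.
Proof.
have [u gu <-] := geodesic_ex x; rewrite (wlengthE gu); case: u {gu} => //=.
by rewrite weval_nil.
Qed.

(** A wall between [b] and [g * b] is passed towards its attracting side, and the positive [g']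
    never passes it back. *)
Lemma Hpos_wlength g g' : Hpos g -> Hpos g' ->
  (wlength S (g ^ b) + wlength S (g' ^ b) = wlength S ((g * g') ^ b))%N.
Proof.
move=> [[gw Cg] g0] [[gw' Cg'] g0'].
have : wle S (g ^ b) ((g * g') ^ b).
  apply/wleP => h.
  have cE x : side S h (x ^ b) = side S (mv b h) (x * b) by rewrite -(side_mv b) conjgE mulVKg.
  have -> : side S h 1 = side S (mv b h) b by rewrite -(side_mv b) mulg1.
  rewrite !cE.
  set k := mv b h => E; case: (pselect (crosses w k)) => wk; last exact: Cg.
  case: (side S k b =P eps w k) => [bE|/neq_negb bE].
    by rewrite bE; apply: (shift_ge0_eps (g0 k.1)).
  rewrite bE; apply: neq_negb => gE; move: E; rewrite bE.
  have -> : side S k (g * g' * b) = eps w k.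
    apply: (@shift_ge0_eps _ _ (g * b)) => //.
    by rewrite -mulgA shift_commute //; apply: g0'.
  by case: eps.
by rewrite /wle conjMg mulKg.
Qed.

Lemma atoms_generate g : Hpos g ->
  exists l : seq G, (forall p, p \in l -> atom p) /\ g = \prod_(p <- l) p.
Proof.
move: {2}(wlength S _) (leqnn (wlength S (g ^ b))) => n.
elim: n g => [|n IH] g gn Hg.
  exists [::]; split=> //; rewrite big_nil; apply: contrapT => g1.
  have /wlength_gt0 : g ^ b <> 1 by move=> /eqP; rewrite conjg_eq1 => /eqP.
  by rewrite ltnNge gn.
case: (pselect (g = 1)) => [->|g1]; first by exists [::]; rewrite big_nil.
case: (pselect (atom g)) => gA.
  by exists [:: g]; rewrite big_seq1; split=> // p; rewrite inE => /eqP->.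
have [g1' [g2' [H1 H2 E n1 n2]]] : exists g1 g2,
    [/\ Hpos g1, Hpos g2, g = g1 * g2, g1 <> 1 & g2 <> 1].
  apply: contrapT => N; apply: gA; split=> // g1' g2' H1 H2 E; apply: contrapT => /not_orP[? ?].
  by apply: N; exists g1', g2'.
have J x : x <> 1 -> (0 < wlength S (x ^ b))%N.
  by move=> x1; apply: wlength_gt0 => /eqP; rewrite conjg_eq1 => /eqP.
have := Hpos_wlength H1 H2; rewrite -E => En.
have [|l1 [A1 E1]] := IH g1' _ H1; first by move: (J _ n2) gn; lia.
have [|l2 [A2 E2]] := IH g2' _ H2; first by move: (J _ n1) gn; lia.
exists (l1 ++ l2); split; last by rewrite big_cat -E1 -E2.
by move=> p; rewrite mem_cat => /orP[/A1|/A2].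
Qed.

Lemma sg_prod s (l : seq G) (F : G -> G) : (forall p, p \in l -> Hstab w b (F p)) ->
  sg s (\prod_(p <- l) F p) = (\sum_(p <- l) sg s (F p))%R.
Proof.
elim: l => [|p l IH] H; first by rewrite !big_nil sg1.
rewrite !big_cons sgM; first by rewrite IH // => q ql; apply: H; rewrite inE ql orbT.
by case: (H p (mem_head _ _)).
Qed.

End Hstab_theory.

End PositiveCone.

(** * Prime decompositions *)

Section Factors.
Implicit Types (s t g w x y z a b p q : G) (h k : G * G) (e d : bool) (n m : nat).
Implicit Types (u v : seq (G * bool)) (c : G * bool) (T U P : set G).

Lemma expgz_conj w a (n : int) : expgz (w ^ a) n = expgz w n ^ a.
Proof. by case: n => n /=; rewrite -conjXg -?conjVg. Qed.

Lemma side_conjg h x a : side S h (x ^ a) = side S (mv a h) (x * a).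
Proof. by rewrite -(side_mv a) conjgE mulVKg. Qed.

Lemma side_mv1 h a : side S h 1 = side S (mv a h) a.
Proof. by rewrite -(side_mv a) mulg1. Qed.

Lemma HgroupP w a g : Xset S w a -> Hgroup S (w ^ a) (g ^ a) <-> Hstab w a g.
Proof.
move=> Xa; have Xa' : Xset S (w ^ a) 1 by apply/Xset_conj; rewrite mulg1.
split=> -[C A]; split.
- have C' : commute (g ^ a) (w ^ a) by exact: C.
  by move: C'; rewrite /commute -!conjMg => /conjg_inj.
- move: A => /(XaxisP _ Xa') A h nh; have := A (mv a^-1 h).
  by rewrite side_conjg (side_mv1 _ a) mvVK; apply; rewrite crosses_conj mvVK.
- by rewrite /centralizer /= /commute -!conjMg C.
- apply/(XaxisP _ Xa') => h; rewrite crosses_conj => nh.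
  by rewrite side_conjg (side_mv1 _ a); apply: A.
Qed.

Lemma Hgroup_cyclic w a : Xset S w a ->
  Hgroup S (w ^ a) = range (expgz (w ^ a)) <-> Hstab w a = range (expgz w).
Proof.
move=> Xa; split=> E; apply/seteqP; split=> g.
- move=> /(HgroupP _ Xa); rewrite E => -[n _]; rewrite expgz_conj => /conjg_inj <-.
  by exists n.
- by move=> [n _ <-]; apply/(HgroupP _ Xa); rewrite E; exists n; rewrite ?expgz_conj.
- rewrite -{1}(conjgKV a g) => /(HgroupP _ Xa); rewrite E => -[n _ H].
  by exists n; rewrite // expgz_conj H conjgKV.
- by move=> [n _ <-]; rewrite expgz_conj; apply/(HgroupP _ Xa); rewrite E; exists n.
Qed.

(** Two points of X_w are separated by crossed walls and by walls fixed by [w], whose labels commute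
    with all crossed labels. So [a^-1 * b] splits in two: one part commutes with [g ^ a], the other
    has only crossed labels. *)
Lemma Hstab_base w a b g : Xset S w a -> Xset S w b -> Hstab w a g -> Hstab w b g.
Proof.
move=> Xa Xb [gw Ca]; split=> // h nh.
have Ra := in_axis_gen Ca; set T := labels w in Ra.
pose U : set G := [set s | T s \/ forall t, T t -> lk S t s].
have Uab : gen S U (a^-1 * b).
  apply: side_gen => k kab; have [T0|[e Te]|[e Te]] := trichotomy w k.
  - by right=> t [k' wk' <-]; apply: type0_lk wk' T0 kab.
  - by left; exists k => //; exists e.
  - by move/XsetP: Xa kab => /(_ _ _ Te) ->; move/XsetP: Xb => /(_ _ _ Te) ->; rewrite eqxx.
have TU s t : U s -> U t -> T s -> ~ T t -> commute s t.
  by move=> _ [//|Ht] Ts _; have [] := Ht _ Ts.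
have Ey := retract_split Uab TU; have R1 := retract_gen T Uab; have R0 := retract_gen (~` T) Uab.
set y1 := retract T _ in Ey R1; set y0 := retract (~` T) _ in Ey R0.
have C01 : commute y1 y0.
  apply: (commute_gen _ R1 R0) => s t _ _ [_ Ts] [[//|Ht] _].
  by have [] := Ht _ Ts.
have Cr0 : commute (g ^ a) y0.
  apply: (commute_gen _ Ra R0) => s t _ _ Ts [[//|Ht] _].
  by have [] := Ht _ Ts.
have Rb : gen S T (b^-1 * (g * b)).
  have -> : b^-1 * (g * b) = (g ^ a) ^ y1.
    have Eb : b = a * y0 * y1 by rewrite -mulgA -C01 -Ey mulVKg.
    transitivity (g ^ b); first by [].
    by rewrite [in LHS]Eb !conjgM (commute_conjg (commute_sym Cr0)).
  rewrite conjgE; have R1' : gen S T y1 by apply: gen_sub R1 => s [].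
  by apply: genM; [exact: genV|apply: genM].
have [T0|[e Te]|[e Te]] := trichotomy w h.
- apply/esym/eqP/negPn/negP => hb; have nT : ~ T h.1.
    by move=> [k wk E]; have := type0_lk wk T0 hb; rewrite E => -[].
  by move: hb; rewrite (gen_side Rb nT) eqxx.
- by case: nh; exists e.
- have /XsetP/(_ _ _ Te) -> : Xset S w (g * b) by apply/Xset_commute.
  by move/XsetP: Xb => /(_ _ _ Te).
Qed.

(** The trivial meet prevents [y] from crossing [h] and [x] from crossing [k]; hence 1, [x], [y] and
    an upper bound occupy the four quadrants. *)
Lemma perp_lk x y h k : perp S x y -> side S h 1 != side S h x -> side S k 1 != side S k y ->
  lk S h.1 k.1.
Proof.
move=> [m1 [z [/wleP xz /wleP yz _]]] hx ky.
have hy : side S h y = side S h 1.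
  have := side_wmeet x y h; rewrite m1 /maj; case: eqP hx => // _ _; by [].
have kx : side S k x = side S k 1.
  have := side_wmeet x y k; rewrite m1 /maj; case: eqP => // _ E.
  by rewrite E eqxx in ky.
have hz : side S h z = ~~ side S h 1.
  by apply: neq_negb => E; move: hx; rewrite xz ?eqxx.
have kz : side S k z = ~~ side S k 1.
  by apply: neq_negb => E; move: ky; rewrite yz ?eqxx.
have hx' : side S h x = ~~ side S h 1 by apply: neq_negb => E; move: hx; rewrite E eqxx.
have ky' : side S k y = ~~ side S k 1 by apply: neq_negb => E; move: ky; rewrite E eqxx.
apply: crossing_lk => e d.
case: (e =P side S h 1) => [->|/neq_negb ->]; case: (d =P side S k 1) => [->|/neq_negb ->].
- by exists 1.
- by exists y.
- by exists x.
- by exists z.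
Qed.

(** * Factors of a prime decomposition are atoms *)

Section Factor.
Context (w b p r : G) (m : nat).
Let L : set G := [set s | exists2 h, side S h b != side S h (p * b) & h.1 = s].
Let L' : set G := [set t | forall s, L s -> lk S s t].
Context (Xb : Xset S w b) (m0 : (0 < m)%N) (wE : w ^ b = (p ^ b) ^+ m * r) (rL : gen S L' r).

Let pL : gen S L (p ^ b).
Proof. by rewrite conjgE; apply: side_gen => h hb; exists h. Qed.

Let pr : commute (p ^ b) r.
Proof. by apply: (commute_gen _ pL rL) => s t _ _ Ls /(_ _ Ls)[]. Qed.

Lemma factor_commute : commute p w.
Proof.
suff : commute (p ^ b) (w ^ b) by rewrite /commute -!conjMg => /conjg_inj.
by rewrite wE; apply: commuteM => //; apply: commuteX.
Qed.

(** The cofactor [r] has its letters in links of [L], so it does not touch walls labelled in [L]: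
    there powers of [w] act on [b] like those of [p ^+ m]. *)
Let sideL (n : int) h : L h.1 -> side S h (expgz w n * b) = side S h (expgz (p ^+ m) n * b).
Proof.
move=> Lh; have bE x : x * b = b * x ^ b by rewrite conjgE mulVKg.
have [R [rR E]] : exists R, gen S L' R /\ expgz w n ^ b = expgz (p ^+ m) n ^ b * R.
  have C : commute ((p ^ b) ^+ m) r by apply: commute_sym; apply: commuteX; apply: commute_sym.
  rewrite -!expgz_conj wE conjXg; case: n => n /=.
    by exists (r ^+ n); split; [exact: genX|rewrite expgMn].
  exists (r ^- n.+1); split; first exact/genV/genX.
  rewrite expgMn // -invgM; congr (_^-1).
  by apply: commuteX2.
rewrite !bE E mulgA; apply/esym; apply: (@gen_side L'); first by rewrite mulKg.
by move=> /(_ _ Lh)[].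
Qed.

(** Were [b] on the side [~~ e], then [p ^+ m] and its inverse would both bring it to [e], and so
    would [w] and [w^-1]; but [b] lies between its images under these two. *)
Let not_out h e : L h.1 -> typeII p h e -> side S h b = e.
Proof.
move=> Lh T; case: (side S h b =P e) => // /neq_negb bE.
have [E1 E2] := T b m bE m0.
have W1 := sideL (Posz 1) Lh; have W2 := sideL (- Posz 1)%R Lh.
rewrite /= !expg1 E1 in W1; rewrite /= !expg1 E2 in W2.
by move/XsetP2: Xb => /(_ h); rewrite W1 W2 bE => /(_ erefl).
Qed.

Lemma factor_Xset : Xset S p b.
Proof.
apply/XsetP => h e T; case: (side S h b =P e) => // /neq_negb bE.
have [] := T b 1%N bE isT; rewrite expg1 => E _.
have Lh : L h.1 by exists h => //; rewrite E bE; case: (e).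
exact: not_out Lh T.
Qed.

Lemma factor_crosses h : L h.1 -> crosses w h -> crosses p h.
Proof.
move=> Lh [e [_ T2 T3]]; apply: contrapT => nph.
have [n1 H1] := T2 b; have [n2 H2] := T3 b.
have HX (n : int) : side S h (expgz w n * b) = side S h b.
  rewrite (sideL n Lh); have [j ->] : exists j : int, expgz (p ^+ m) n = expgz p j.
    case: n => n /=; first by exists (Posz (m * n)); rewrite /= expgnA.
    by exists (- Posz (m * n.+1))%R; rewrite expgzN expgnA.
  exact: side_expgz factor_Xset nph.
have := HX (Posz n1); have := HX (- Posz n2)%R; rewrite expgzN /= H1 H2 => <-.
by case: (e).
Qed.

Lemma factor_sep h : side S h b != side S h (p * b) ->
  [/\ crosses w h, side S h b = ~~ eps w h & side S h (p * b) = eps w h].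
Proof.
move=> hb; have Lh : L h.1 by exists h.
have [T|[e T]|[e T]] := trichotomy p h.
- by move: hb; rewrite T eqxx.
- have [T1 T2 T3] := T.
  have bE : side S h b = ~~ e by apply: neq_negb => E; move: hb; rewrite E T1 // eqxx.
  have pbE : side S h (p * b) = e.
    by move: hb; rewrite bE; case: side; case: (e).
  have ev n : (0 < n)%N -> side S h (w ^+ n * b) = e.
    have := sideL (Posz n) Lh => /= -> n0; rewrite -expgnA.
    have : (0 < m * n)%N by rewrite muln_gt0 m0.
    case: (m * n)%N => // j _; rewrite expgSr -mulgA; exact: mono_expg.
  have ev' : side S h (w^-1 * b) = ~~ e.
    have := sideL (- Posz 1)%R Lh => /=; rewrite !expg1 => ->.
    exact: mono_expVg.
  have wh : crosses w h.
    apply: contrapT => nh.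
    have := side_expgz (Posz 1) Xb nh; have := side_expgz (- Posz 1)%R Xb nh.
    by rewrite /= expg1 ev' => <-; have := ev 1%N isT; rewrite expg1 => ->; case: (e).
  have <- : e = eps w h.
    by rewrite -(lim_crosses b wh); apply/esym; apply: (@lim_eq _ _ _ _ 1%N) => n; exact: ev.
  by split.
(* The translate of [h] by [p^-1] is of [typeII] too, with the same label; so [b] and [p * b] are
   both on the side [e]. *)
- have E1 := not_out Lh T.
  have Tp : typeII p (mv p^-1 h) e.
    by apply/typeII_conj; rewrite commute_conjg //; apply: commuteVl.
  have := @not_out (mv p^-1 h) e Lh Tp; rewrite side_mvE invgK => E2.
  by move: hb; rewrite E1 E2 eqxx.
Qed.

Lemma factor_Hpos : Hpos w b p.
Proof.
split.
  split; first exact: factor_commute.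
  move=> h nh; apply/esym/eqP/negPn/negP => /factor_sep[/nh []].
move=> s; rewrite /sg; apply: shift_ge0 => k _ wk kE; apply/eqP/negPn/negP => N.
have [|_] := @factor_sep k; first by rewrite kE eq_sym.
by rewrite kE; case: eps.
Qed.

(** A positive factor [g] of [p] moves [b] only across walls crossed by [p], so it is a power of
    [p]; positivity of both factors leaves the exponents 0 and 1. *)
Lemma factor_atom : p <> 1 -> Hstab p b = range (expgz p) -> atom w b p.
Proof.
move=> p1 HE; have [Hp p0] := factor_Hpos; split=> // g g' Hg Hg' pE.
have [[gw Cg] g0] := Hg; have [Hg'' g0'] := Hg'.
have sgE s : sg w b s p = (sg w b s g + sg w b s g')%R by rewrite pE sgM.
have [n _ gn] : range (expgz p) g.
  rewrite -HE; split.
    by rewrite pE; apply: commuteM => //; apply: Hstab_commute Hg''.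
  move=> h nh; apply/esym/eqP/negPn/negP => hb.
  have wh : crosses w h by apply: contrapT => nw; move: hb; rewrite Cg // eqxx.
  apply: nh; apply: (factor_crosses _ wh); apply: contrapT => nL.
  have : sg w b h.1 p = 0%R by apply: shift_gen nL; rewrite -conjgE.
  rewrite sgE => E; have gz : sg w b h.1 g = 0%R by move: (g0 h.1) (g0' h.1) E; lia.
  by move: hb; rewrite (shift_eq0 gz wh) eqxx.
have [s sp] : exists s, sg w b s p <> 0%R.
  by apply: contrapT => /forallNP N; apply: p1; apply: (sg_inj Hp) => s; apply: contrapT; exact: N.
have pw := factor_commute.
have [n0|n1] : n = 0%R \/ n = 1%R.
  move: (g0 s) (g0' s) (p0 s) (sgE s); rewrite -gn sg_expgz //.
  set A := sg _ _ _ _ in sp *; set B := sg _ _ _ _; clearbody A B; nia.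
- by left; rewrite -gn n0.
- by right; apply: (@mulgI _ g); rewrite mulg1 -pE -gn n1 /= expg1.
Qed.

End Factor.

(** Orthogonality at [b] makes the label sets of the factors disjoint and commuting, so a retraction
    of [w ^ b] isolates the product of the other powers. [Hstab_base] carries cyclicity from the
    point given by [primitive] to [b]. *)
Lemma Xset_prim_atom w b n (p : 'I_n -> G) (m : 'I_n -> nat) i : Xset S w b ->
  is_prim_decomposition S w p m -> atom w b (p i).
Proof.
move=> Xb [wE pP m1 pperp].
pose L j : set G := [set s | exists2 h, side S h b != side S h (p j * b) & h.1 = s].
have Lij j s t : i != j -> L i s -> L j t -> lk S s t.
  move=> ij [h hb <-] [k kb <-].
  have := @perp_lk _ _ (mv b^-1 h) (mv b^-1 k) (pperp _ _ ij b Xb).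
  by rewrite !side_conjg !(side_mv1 _ b) !mvVK; apply.
have pL j : gen S (L j) (p j ^ b) by rewrite conjgE; apply: side_gen => h hb; exists h.
pose U : set G := [set s | exists j, L j s].
have vE : w ^ b = \prod_(j < n) (p j ^ b) ^+ m j.
  by rewrite wE conjg_prod; apply: eq_bigr => j _; rewrite conjXg.
have vU : gen S U (w ^ b).
  rewrite vE; apply: big_ind => [||j _]; [exact: gen1|exact: genM|].
  by apply: genX; apply: gen_sub (pL j) => s; exists j.
have LU s t : U s -> U t -> L i s -> ~ L i t -> lk S s t.
  move=> _ [j Ljt] Lis nLit; apply: (Lij j) => //.
  by apply/eqP => ij; apply: nLit; rewrite ij.
have [p1 [a Xa /(Hgroup_cyclic Xa) HE]] := pP i.
have E : w ^ b = (p i ^ b) ^+ m i * retract (~` L i) (w ^ b).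
  rewrite {1}(@retract_split (L i) _ _ vU) => [|s t Us Ut Ls Lt]; last first.
    by have [] := LU s t Us Ut Ls Lt.
  congr (_ * _); rewrite vE (big_morph (retract (L i)) (id1 := 1) (op1 := fun x y => x * y)).
  - rewrite (eq_bigr (fun j => if j == i then (p i ^ b) ^+ m i else 1)) => [|j _].
      by rewrite -big_mkcond big_pred1_eq.
    case: eqP => [->|/eqP ji]; first by rewrite (@retract_id _ (L i)) //; exact: genX.
    apply: (@retract_1 _ (L j)); first exact: genX.
    by move=> s Ljs Lis; have := Lij j s s; rewrite eq_sym ji => /(_ isT Lis Ljs)[].
  - exact: retractM.
  - by apply: (@retract_1 _ set0) => //; exact: gen1.
have R : gen S [set t | forall s, L i s -> lk S s t] (retract (~` L i) (w ^ b)).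
  apply: gen_sub (retract_gen _ vU) => t [Ut nLt] s Ls; apply: LU => //.
  by exists i.
have Xpb := factor_Xset Xb (m1 i) E R.
apply: (factor_atom Xb (m1 i) E R) => //.
apply/seteqP; split=> g.
  by move=> /(Hstab_base Xpb Xa); rewrite HE.
by rewrite -HE; apply: Hstab_base.
Qed.

End Factors.

(** * Atoms are primitive, decompose [w], and form a basis *)

Section Decomposition.
Implicit Types (s t g w x y z a b p q : G) (h k : G * G) (e d : bool) (n m : nat).
Implicit Types (u v : seq (G * bool)) (c : G * bool) (T U P : set G) (l : seq G).

Lemma commute_prod_seq x l : (forall y, y \in l -> commute x y) -> commute x (\prod_(y <- l) y).
Proof.
elim: l => [|y l IH] H; first by rewrite big_nil; exact: commute1.
rewrite big_cons; apply: commuteM; first by apply: H; rewrite mem_head.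
by apply: IH => z zl; apply: H; rewrite inE zl orbT.
Qed.

Section Atoms.
Context (w b : G) (Xb : Xset S w b).

Lemma Hstab_expgz g (n : int) : Hstab w b g -> Hstab w b (expgz g n).
Proof.
move=> Hg; have HX m : Hstab w b (g ^+ m).
  by elim: m => [|m IH]; [exact: Hstab1|rewrite expgS; exact: HstabM].
by case: n => n /=; [exact: HX|exact: HstabV].
Qed.

Lemma sg_ge0_sep g h : Hpos w b g -> side S h b != side S h (g * b) ->
  [/\ crosses w h, side S h b = ~~ eps w h, side S h (g * b) = eps w h & (0 < sg w b h.1 g)%R].
Proof.
move=> [[gw Cg] g0] hb.
have wh : crosses w h by apply: contrapT => nh; move: hb; rewrite Cg // eqxx.
have bE : side S h b = ~~ eps w h.
  apply: neq_negb => E; move: hb.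
  by rewrite (shift_ge0_eps (g0 h.1) wh E) E eqxx.
have gE : side S h (g * b) = eps w h by move: hb; rewrite bE; case: side; case: eps.
by split=> //; exact: shift_gt0.
Qed.

(** If [b] were not between [p^-1 * b] and [p * b], some wall would be passed positively from [b] to
    [p * b] and its translate by [p] negatively. *)
Lemma Hpos_Xset p : Hpos w b p -> Xset S p b.
Proof.
move=> Hp; apply/XsetP2 => h E; apply/eqP/negPn/negP => hb.
have [wh bE pbE _] := sg_ge0_sep Hp hb.
have E1 : side S (mv p h) b = eps w h by rewrite side_mvE -E.
have E2 : side S (mv p h) (p * b) = ~~ eps w h by rewrite side_mv.
have [|wph] := @sg_ge0_sep p (mv p h) Hp; first by rewrite E1 E2; case: eps.
have [[pw _] _] := Hp.
by rewrite E1 eps_commute //; case: eps.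
Qed.

Lemma sg_neq0_gt0 s g : Hpos w b g -> sg w b s g <> 0%R -> (0 < sg w b s g)%R.
Proof. by move=> [_ /(_ s)]; lia. Qed.

Lemma atom_sg p : atom w b p -> exists s, (0 < sg w b s p)%R.
Proof.
move=> [Hp p1 _]; apply: contrapT => /forallNP N; apply: p1; apply: (sg_inj (proj1 Hp)) => s.
by apply: contrapT => /(sg_neq0_gt0 Hp); apply: N.
Qed.

Lemma atom_same p q s : atom w b p -> atom w b q -> (0 < sg w b s p)%R -> (0 < sg w b s q)%R ->
  p = q.
Proof.
move=> Ap Aq ps qs; apply: contrapT => pq.
by case: (atom_disjoint Xb s Ap Aq pq) => E; [move: ps|move: qs]; rewrite E ltxx.
Qed.

Lemma sg_prod_ge s l p : (forall q, q \in l -> Hpos w b q) -> p \in l ->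
  (sg w b s p <= sg w b s (\prod_(q <- l) q))%R.
Proof.
move=> H pl; rewrite (sg_prod s (fun q ql => proj1 (H q ql))).
case/splitPr: pl H => l1 l2 H; rewrite big_cat big_cons /=.
have P l' : {subset l' <= l1 ++ p :: l2} -> (0 <= \sum_(q <- l') sg w b s q)%R.
  by move=> l'l; rewrite big_seq; apply: sumr_ge0 => q /l'l /H[].
have P1 : (0 <= \sum_(q <- l1) sg w b s q)%R by apply: P => q ql; rewrite mem_cat ql.
have P2 : (0 <= \sum_(q <- l2) sg w b s q)%R by apply: P => q ql; rewrite mem_cat inE ql !orbT.
by rewrite addrCA lerDl addr_ge0.
Qed.

Lemma Hpos_power p g : atom w b p -> Hpos w b g ->
  (forall s, (0 < sg w b s g)%R -> (0 < sg w b s p)%R) -> exists n, g = p ^+ n.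
Proof.
move=> Ap Hg gp; have [l [Al gE]] := atoms_generate Hg; exists (size l).
have Hl q : q \in l -> Hpos w b q by move=> /Al[].
have lp q : q \in l -> q = p.
  move=> ql; have [s qs] := atom_sg (Al _ ql); apply: (atom_same (s := s)) => //; first exact: Al.
  by apply: gp; rewrite gE; apply: lt_le_trans qs _; exact: sg_prod_ge.
rewrite gE; elim: l lp {Al gE Hl} => [|q l IH] lp; first by rewrite big_nil.
rewrite big_cons (lp q (mem_head _ _)) IH ?expgS // => r rl.
by apply: lp; rewrite inE rl orbT.
Qed.

Lemma Hstab_power p g : atom w b p -> Hstab w b g ->
  (forall s, sg w b s g <> 0%R -> (0 < sg w b s p)%R) -> exists n : int, g = expgz p n.
Proof.
move=> Ap Hg gp; have [k [Hk Hl kE]] := Hpos_part Xb Hg.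
have [gw _] := Hg.
have [n kn] : exists n, k = p ^+ n.
  by apply: Hpos_power => // s; rewrite kE => s0; apply: gp => E; move: s0; rewrite E; lia.
have [m lm] : exists m, g^-1 * k = p ^+ m.
  apply: Hpos_power => // s; rewrite sgM ?sgV ?kE //; last exact: commuteVl.
  by move=> s0; apply: gp => E; move: s0; rewrite E; lia.
have -> : g = p ^+ n * (p ^+ m)^-1 by rewrite -kn -lm invgM invgK mulVKg.
case: (leqP m n) => mn; first by exists (Posz (n - m)); rewrite /= expgnFr.
exists (- Posz (m - n))%R; rewrite expgzN expgnFr ?invgM ?invgK //; exact: ltnW.
Qed.

Lemma atom_crosses p h : Hstab w b p -> Hpos w b p -> crosses p h ->
  crosses w h /\ (0 < sg w b h.1 p)%R.
Proof.
move=> Hp Hp0 [e [_ T2 T3]]; have [n1 H1] := T2 b; have [n2 H2] := T3 b.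
have N : ~ forall n : int, side S h (expgz p n * b) = side S h b.
  move=> E; move: (E (Posz n1)) (E (- Posz n2)%R); rewrite expgzN /= H1 H2 => <-.
  by case: (e).
have wh : crosses w h.
  by apply: contrapT => nh; apply: N => n; have [_] := Hstab_expgz n Hp; apply.
split=> //; apply: sg_neq0_gt0 => // E; apply: N => n.
apply/esym; apply: (@shift_eq0 w) => //.
have [pw _] := Hp; have := sg_expgz b h.1 n pw.
by rewrite E mul0r.
Qed.

Lemma w_atoms : exists l, (forall p, p \in l -> atom w b p) /\ w = \prod_(p <- l) p.
Proof.
apply: atoms_generate; split=> [|s]; first exact: Hstab_w.
case: (pselect (labels w s)) => Ls; first exact/ltW/sg_w_gt0.
by rewrite (sg_labels (Hstab_w Xb) Ls).
Qed.

Lemma atom_lk p s t : atom w b p -> (0 < sg w b s p)%R -> labels w t -> sg w b t p = 0%R ->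
  lk S s t.
Proof.
move=> [[Hp _] _ _] ps Lt pt; have [pw _] := Hp; apply: (sg_sign_lk pw _ Lt ps).
  by apply: contrapT => nL; move: ps; rewrite (sg_labels Hp nL) ltxx.
by rewrite pt.
Qed.

(** The labels of the other atoms commute with those of [p], so an element of the left side commutes
    with all atoms in [w], hence with [w]. It then lies in the stabilizer for [w], supported where
    [p] is, and is a power of [p]. *)
Lemma atom_cyclic p : atom w b p -> Hstab p b = range (expgz p).
Proof.
move=> Ap; have [Hp p1 _] := Ap; have Xpb := Hpos_Xset Hp; have [Hp' _] := Hp.
have Hpp := Hstab_w Xpb.
apply/seteqP; split=> g; last first.
  move=> [n _ <-]; split; first exact: expgz_commute.
  exact: in_axis_expgz.
move=> [gp Cg]; have Rg := in_axis_gen Cg.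
have Lp s : labels p s -> (0 < sg w b s p)%R.
  by move=> [h ph <-]; have [] := atom_crosses Hp' Hp ph.
have gw : commute g w.
  have [l [Al ->]] := w_atoms; apply: commute_prod_seq => q /Al Aq.
  case: (pselect (p = q)) => [<- //|pq].
  have [[Hq q0] _ _] := Aq.
  have Rq : gen S [set t | labels w t /\ (0 < sg w b t q)%R] (q ^ b).
    rewrite conjgE; apply: side_gen => h hb; have [wh _ _ ?] := sg_ge0_sep (conj Hq q0) hb.
    by split=> //; exists h.
  suff : commute (g ^ b) (q ^ b) by rewrite /commute -!conjMg => /conjg_inj.
  apply: (commute_gen _ Rg Rq) => s t _ _ /Lp ps [Lt qt].
  suff [] : lk S s t by [].
  apply: (atom_lk Ap ps Lt).
  by case: (atom_disjoint Xb t Ap Aq pq) => // E; move: qt; rewrite E ltxx.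
have Hg : Hstab w b g.
  split=> // h nh; apply: Cg => ph; apply: nh; by have [] := atom_crosses Hp' Hp ph.
have [|n ->] := Hstab_power Ap Hg; last by exists n.
move=> s gs; apply: Lp; apply: contrapT => nL; apply: gs.
exact: (shift_gen _ Rg nL).
Qed.

Lemma atom_primitive p : atom w b p -> primitive S p.
Proof.
move=> Ap; have [Hp p1 _] := Ap; split=> //; have Xpb := Hpos_Xset Hp.
by exists b => //; apply/(Hgroup_cyclic Xpb); exact: atom_cyclic.
Qed.

Lemma atom_perp p q : atom w b p -> atom w b q -> p <> q -> perp S (p ^ b) (q ^ b).
Proof.
move=> Ap Aq pq; have [Hp _ _] := Ap; have [Hq _ _] := Aq.
have disj k : side S k b = side S k (p * b) \/ side S k b = side S k (q * b).
  case: (side S k b =P side S k (p * b)) => [|/eqP kp]; [by left|right].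
  apply/eqP/negPn/negP => kq.
  have [_ _ _ pk] := sg_ge0_sep Hp kp; have [_ _ _ qk] := sg_ge0_sep Hq kq.
  exact: pq (atom_same Ap Aq pk qk).
have [[pw Cp] _] := Hp; have [[qw Cq] _] := Hq.
have [[Hp' _] [Hq' _]] := (Hp, Hq).
have prod k : side S k (p * q * b) = side S k (p * b) /\ side S k (q * b) = side S k b \/
    side S k (p * q * b) = side S k (q * b) /\ side S k (p * b) = side S k b.
  case: (pselect (crosses w k)) => wk; last first.
    by left; rewrite Cq // -mulgA (in_axis_M pw Cp Cq) ?Cp.
  case: (atom_disjoint Xb k.1 Ap Aq pq) => E; [right|left]; split.
  - rewrite (Hstab_commute Hp' Hq'); apply/esym; apply: (shift_eq0 _ wk).
    by rewrite -mulgA shift_commute.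
  - by apply/esym; apply: (shift_eq0 E wk).
  - apply/esym; apply: (shift_eq0 _ wk).
    by rewrite -mulgA shift_commute.
  - by apply/esym; apply: (shift_eq0 E wk).
split.
  apply: side_inj => h; rewrite side_wmeet !side_conjg !(side_mv1 h b) /maj.
  by case: eqP => // N; case: (disj (mv b h)).
(* Every wall sees at most one of [p] and [q] move [b], so the product is the least upper bound. *)
exists ((p * q) ^ b); split.
- apply/wleP => h; rewrite !side_conjg !(side_mv1 h b) => E.
  by case: (prod (mv b h)) => -[E1 E2]; rewrite ?E2 // -E1.
- apply/wleP => h; rewrite !side_conjg !(side_mv1 h b) => E.
  by case: (prod (mv b h)) => -[E1 E2]; rewrite ?E2 // -E1.
- move=> t /wleP tp /wleP tq; apply/wleP => h E; have := tp h E; have := tq h E.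
  rewrite !side_conjg !(side_mv1 h b).
  by case: (prod (mv b h)) => -[-> _].
Qed.

End Atoms.

Lemma sg_base w a b s g : Hstab w a g -> sg w a s g = sg w b s g.
Proof. by move=> [gw _]; exact: shift_base. Qed.

Lemma Hpos_base w a b g : Xset S w a -> Xset S w b -> Hpos w a g -> Hpos w b g.
Proof.
move=> Xa Xb [Hg g0]; split; first exact: Hstab_base Hg.
by move=> s; rewrite -(sg_base b s Hg).
Qed.

Lemma atom_base w a b p : Xset S w a -> Xset S w b -> atom w a p -> atom w b p.
Proof.
move=> Xa Xb [Hp p1 pA]; split=> //; first exact: Hpos_base Hp.
by move=> g g' Hg Hg'; apply: pA; [exact: Hpos_base Hg|exact: Hpos_base Hg'].
Qed.

(** Every atom occurs in a factorization of [w] into atoms: on its support [w] is positive, and the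
    other atoms vanish. Orthogonality is required at all points of X_w, hence the recourse to
    [atom_base]. *)
Lemma atoms_decomposition w b : Xset S w b ->
  exists (n : nat) (p : 'I_n -> G) (m : 'I_n -> nat), is_prim_decomposition S w p m /\
    forall q, atom w b q -> range p q.
Proof.
move=> Xb; have [l [Al wE]] := w_atoms Xb.
have Hl q : q \in l -> Hstab w b q by move=> /Al[[]].
pose r := undup l; exists (size r), (fun i => nth 1 r i), (fun i => count_mem (nth 1 r i) l).
have rl i : (i < size r)%N -> nth 1 r i \in l by move=> ir; rewrite -mem_undup mem_nth.
split; last first.
  move=> q Aq; have [s qs] := atom_sg Aq.
  have ql : q \in l.
    apply: contrapT => nql; have [[Hq _] _ _] := Aq.
    have Ls : labels w s.
      by apply: contrapT => nL; move: qs; rewrite (sg_labels Hq nL) ltxx.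
    have := sg_w_gt0 b Ls; rewrite {2}wE sg_prod // big1_seq ?ltxx // => p /andP[_ pl].
    case: (atom_disjoint Xb s Aq (Al _ pl)) => // [qp|E]; first by apply: nql; rewrite qp.
    by move: qs; rewrite E ltxx.
  have qr : q \in r by rewrite mem_undup.
  have ir : (index q r < size r)%N by rewrite index_mem.
  by exists (Ordinal ir) => //=; rewrite nth_index.
split.
- pose F q := q ^+ count_mem q l.
  have HF q : q \in r -> Hstab w b (F q).
    by rewrite mem_undup => /Hl Hq; exact: (Hstab_expgz (Posz _)).
  transitivity (\prod_(q <- r) F q); last by rewrite (big_nth 1) big_mkord.
  have Hr : Hstab w b (\prod_(q <- r) F q).
    rewrite big_seq; apply: big_ind => [||q qr]; [exact: Hstab1|exact: HstabM|exact: HF].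
  apply: (Hstab_inj (Hstab_w Xb) Hr) => s.
  rewrite {2}wE !sg_prod // -big_undup_iterop_count; apply: eq_big_seq => q qr.
  have [qw _] := Hl q (etrans (esym (mem_undup l q)) qr).
  by rewrite sgX.
- by move=> i; apply: (@atom_primitive w b Xb); apply: Al; apply: rl.
- by move=> i; rewrite -has_count has_pred1; apply: rl.
- move=> i j ij a Xa; have A i' : atom w a (nth 1 r (nat_of_ord (i' : 'I_(size r)))).
    by apply: (atom_base Xb Xa); apply: Al; apply: rl.
  apply: (atom_perp Xa) => // /eqP; rewrite nth_uniq ?undup_uniq //.
  by move/eqP/val_inj => E; move: ij; rewrite E eqxx.
Qed.

Lemma Prim_atoms w b : Xset S w b -> Prim S w = [set p | atom w b p].
Proof.
move=> Xb; apply/seteqP; split=> q.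
  by move=> [n [p [m [D [i _ <-]]]]]; exact: (Xset_prim_atom i Xb D).
move=> Aq; have [n [p [m [D H]]]] := atoms_decomposition Xb.
by exists n, p, m; split=> //; apply: H.
Qed.

(** Conjugation by [g] moves the base point to [g * b], which [Hstab_base] undoes, and preserves the
    signed numbers; these determine the atom, which is therefore fixed. *)
Lemma centralizer_Prim w : centralizer w = \bigcap_(p in Prim S w) centralizer p.
Proof.
have Xb := Xset_phi w 1; set b := phi S w 1 in Xb.
rewrite (Prim_atoms Xb); apply/seteqP; split=> g.
  move=> gw p [[Hp _] _ _]; have [pw Cp] := Hp.
  have Xgb : Xset S w (g * b) by apply/Xset_commute.
  have gpw : commute (g * p * g^-1) w.
    apply: commute_sym; apply: commuteM; last by apply: commuteV; apply: commute_sym.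
    by apply: commuteM; apply: commute_sym.
  have H1 : Hstab w (g * b) (g * p * g^-1).
    split=> // h nh; rewrite mulgA mulgVK -(mvVK g h) -mulgA !side_mv; apply: Cp.
    by apply: contra_not nh => /(crosses_commute _ (commuteVl gw)).
  have := Hstab_inj (Hstab_base Xgb Xb H1) Hp.
  move=> E; rewrite /centralizer /= /commute -[in RHS]E ?mulgVK // => s.
  rewrite sgM; last by apply: commute_sym; apply: commuteM; apply: commute_sym.
  by rewrite sgM // sgV // addrAC addrN add0r.
move=> H; have [l [Al ->]] := w_atoms Xb; apply: commute_prod_seq => q /Al; exact: H.
Qed.

Lemma is_subgroupM (M : set G) x y : is_subgroup M -> M x -> M y -> M (x * y).
Proof.
move=> [M1 MV] Mx My; rewrite -[y]invgK; apply: (MV) => //.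
by rewrite -[y^-1]mul1g; apply: MV.
Qed.

(** Generation: every element is a quotient of two positive ones. Independence: at a label in the
    support of [p] the other atoms vanish, so a relation forces the exponent of [p] to be zero. *)
Lemma Hstab_free_abelian w b : Xset S w b -> free_abelian_on (Hstab w b) (Prim S w).
Proof.
move=> Xb; rewrite (Prim_atoms Xb); split.
- apply/seteqP; split=> g; last first.
    apply; split=> [|p [[]] //]; split; first exact: Hstab1.
    by move=> x y Hx Hy; apply: HstabM => //; exact: HstabV.
  move=> Hg M [MG MA]; have [k [Hk Hl _]] := Hpos_part Xb Hg.
  have MP x : Hpos w b x -> M x.
    move=> /atoms_generate[l [Al ->]]; rewrite big_seq.
    by apply: big_ind => [||p /Al /MA //]; [case: MG|move=> y z; exact: is_subgroupM].
  have -> : g = k * (g^-1 * k)^-1 by rewrite invgM invgK mulVKg.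
  by have [_ MV] := MG; apply: MV; apply: MP.
- by move=> p q [[Hp _] _ _] [[Hq _] _ _]; exact: (Hstab_commute Hp Hq).
- move=> l n ul Al E p pl; have [s ps] := atom_sg (Al _ pl).
  have Hq q : q \in l -> Hstab w b q by move=> /Al[[]].
  have := sg_prod s (fun q ql => Hstab_expgz (n q) (Hq q ql)).
  rewrite E sg1 (bigD1_seq p) //= big1_seq => [|q /andP[qp ql]]; last first.
    have [qw _] := Hq _ ql; rewrite sg_expgz //.
    case: (atom_disjoint Xb s (Al _ pl) (Al _ ql)) => [pq|E0|->]; last by rewrite mul0r.
      by move: qp; rewrite pq eqxx.
    by move: ps; rewrite E0 ltxx.
  have [pw _] := Hq _ pl; rewrite addr0 sg_expgz // => /esym/eqP.
  by rewrite mulf_eq0 => /orP[/eqP E0|/eqP //]; move: ps; rewrite E0 ltxx.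
Qed.

End Decomposition.

End RightAngledArtin.

Theorem corollary8p18 (G : groupType) (S : set G) (GS : is_raag S) :
  (forall w : G,
     [/\ Stab act_op (bullet S w) = Stab act_map (phi S w),
         Stab act_map (phi S w) = Stab act_set (Xset S w),
         Stab act_set (Xset S w) = centralizer w
       & centralizer w = \bigcap_(p in Prim S w) centralizer p]) /\
  (forall w a : G,
     [/\ Stab act_op (vee S w a) = Stab act_map (Psi S w (phi S w a)),
         Stab act_map (Psi S w (phi S w a)) =
           Stab act_set (Xaxis S w (phi S w a))
       & free_abelian_on (Stab act_set (Xaxis S w (phi S w a))) (Prim S w)]).
Proof.
split=> [w|w a].
  by rewrite (stab_bullet GS) (stab_phi GS) (stab_Xset GS); split=> //; exact: centralizer_Prim.
have Xb := Xset_phi S w a.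
rewrite (stab_vee GS) (stab_Psi GS Xb) (stab_axis GS Xb); split=> //.
exact: Hstab_free_abelian.
Qed.
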